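(* Fix a prime power $q$. For each positive integer $m$ with $Q=q^m>2$, define the positive integers \[ r=\frac{(Q^2+1)(Q-1)}{q-1},\qquad j=\frac{Q-1}{q-1},\qquad s=\frac{Q^2(Q-1)}{q}. \] These parameters satisfy \[ s=\left(1-\frac1q\right)(r-j)<r,\qquad j\sim (q-1)^{-2/3}r^{1/3}\quad\text{as } m\to\infty. \] Along this sequence (as $m\to\infty$ with $q$ fixed), \[ R(q+1;r,s)=\Theta_q(r^{4/3})\qquad\text{and}\qquad A_q(r,s)=(1+o(1))(q-1)^{4/3}r^{4/3}. \]
   Context: For positive integers $k,r,s$ with $r>s$, the set-coloring Ramsey number $R(k;r,s)$ is the least $N$ such that every assignment of an $s$-element subset of $[r]=\{1,\dots,r\}$ to each edge of the complete graph $K_N$ yields a copy of $K_k$ whose edges share a common color (i.e. some $c\in[r]$ belongs to the sets assigned to all edges of that copy). A $q$-ary code of length $r$ is a subset of $[q]^r$; its minimum Hamming distance is the least number of coordinates in which two distinct codewords differ. $A_q(r,d)$ denotes the maximum size of a $q$-ary code of length $r$ with minimum Hamming distance at least $d$. The notation $\Theta_q$ means that the implied positive constants depend only on $q$; $f\sim g$ means $f/g\to1$; $o(1)$ denotes a quantity tending to $0$ as $m\to\infty$ with $q$ fixed. *)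

(* Defs.v *)
From mathcomp Require Import boolp classical_sets.
From mathcomp Require Import all_boot.

Set Implicit Arguments.
Unset Strict Implicit.
Unset Printing Implicit Defensive.

(* The vertices of K_N are 'I_N, the edges are the 2-element vertex sets, and
   the palette is 'I_r.  The values of [c] on vertex sets that are not edges
   are irrelevant. *)
Definition set_coloring (N r s : nat) (c : {set 'I_N} -> {set 'I_r}) : Prop :=
  forall e : {set 'I_N}, #|e| = 2 -> #|c e| = s.

Definition common_color_clique (N r k : nat) (c : {set 'I_N} -> {set 'I_r})
    (S : {set 'I_N}) : Prop :=
  #|S| = k /\
  exists a : 'I_r, forall e : {set 'I_N}, e \subset S -> #|e| = 2 -> a \in c e.

Definition set_arrow (k r s N : nat) : Prop :=
  forall c : {set 'I_N} -> {set 'I_r},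
    set_coloring s c -> exists S : {set 'I_N}, common_color_clique k c S.

Definition is_set_ramsey (k r s N : nat) : Prop :=
  set_arrow k r s N /\ forall M : nat, set_arrow k r s M -> N <= M.

(* The default value 0 is not used when 0 < s < r: see [set_ramseyP]. *)
Definition set_ramsey (k r s : nat) : nat :=
  xget 0 [set N | is_set_ramsey k r s N]%classic.

Definition hamming (q r : nat) (x y : {ffun 'I_r -> 'I_q}) : nat :=
  #|[set i | x i != y i]|.

Definition min_dist_geq (q r d : nat) (C : {set {ffun 'I_r -> 'I_q}}) : bool :=
  [forall x in C, forall y in C, (x != y) ==> (d <= hamming x y)].

Definition max_code (q r d : nat) : nat :=
  \max_(C : {set {ffun 'I_r -> 'I_q}} | min_dist_geq d C) #|C|.

Definition prime_power (q : nat) : Prop :=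
  exists p n : nat, [/\ prime p, 0 < n & q = p ^ n].

Definition par_r (q m : nat) : nat :=
  ((q ^ m) ^ 2 + 1) * (q ^ m - 1) %/ (q - 1).

Definition par_j (q m : nat) : nat := (q ^ m - 1) %/ (q - 1).

Definition par_s (q m : nat) : nat := (q ^ m) ^ 2 * (q ^ m - 1) %/ q.

Lemma multicolor_ramsey (r n : nat) (k : 'I_r -> nat) :
  \sum_i k i = n ->
  exists N, forall (T : finType) (V : {set T}) (c : {set T} -> 'I_r),
    N <= #|V| ->
    exists (i : 'I_r) (S : {set T}),
      [/\ S \subset V, #|S| = k i &
          forall e : {set T}, e \subset S -> #|e| = 2 -> c e = i].
Proof.
elim: n k => [|n IHn] k sumk.
  exists 0 => T V c _; exists (c finset.set0), finset.set0; split=> [||e].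
  - by rewrite sub0set.
  - rewrite cards0; apply/esym/eqP; rewrite -leqn0 -sumk.
    by rewrite (bigD1 (c finset.set0)) //= leq_addr.
  - by rewrite subset0 => /eqP ->; rewrite cards0.
have [/existsP[i0 /eqP ki0]|/existsPn kN0] := boolP [exists i, k i == 0].
  exists 0 => T V c _; exists i0, finset.set0; split=> [||e].
  - by rewrite sub0set.
  - by rewrite cards0 ki0.
  - by rewrite subset0 => /eqP ->; rewrite cards0.
pose k' i j := if j == i then (k j).-1 else k j.
have sumk' i : \sum_j k' i j = n.
  apply/eqP; rewrite -eqSS -sumk (bigD1 i) //= [X in _ == X](bigD1 i) //=.
  rewrite /k' eqxx -addSn prednK ?lt0n ?kN0 // eqn_add2l.
  by apply/eqP; apply: eq_bigr => j /negbTE ->.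
have [N HN] := boolp.choice (fun i => IHn (k' i) (sumk' i)).
exists (\sum_i N i).+2 => T V c leNV.
have [v vV] : exists v, v \in V by apply/card_gt0P; apply: leq_trans leNV.
pose W i := [set w in V :\ v | c [set v; w] == i].
have [i leNW] : exists i, N i <= #|W i|.
  apply/existsP; apply: contraT => /existsPn ltWN.
  have cardW : #|V :\ v| = \sum_i #|W i|.
    rewrite -sum1_card (partition_big (fun w => c [set v; w]) xpredT) //=.
    by apply: eq_bigr => i _; rewrite -sum1_card; apply: eq_bigl => w; rewrite !inE.
  have : \sum_i #|W i| <= \sum_i N i.
    by apply: leq_sum => i _; have := ltWN i; rewrite -ltnNge => /ltnW.
  by rewrite -cardW leqNgt; move: leNV; rewrite (cardsD1 v) vV add1n ltnS => ->.
have [j [S [SW cardS monoS]]] := HN i T (W i) c leNW.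
have SV : S \subset V.
  by apply: fintype.subset_trans SW _; apply/subsetP => w; rewrite !inE => /andP[/andP[_ ->]].
have [eji|neji] := eqVneq j i; last first.
  by exists j, S; split=> //; rewrite cardS /k' (negbTE neji).
exists i, (v |: S); split.
- by rewrite finset.subUset sub1set vV.
- have vS : v \notin S.
    by apply/negP => /(subsetP SW); rewrite !inE eqxx.
  by rewrite cardsU1 vS cardS /k' eji eqxx add1n prednK ?lt0n ?kN0.
move=> e eS card_e; have [ve|vNe] := boolP (v \in e); last first.
  rewrite -eji; apply: monoS => //; apply/subsetP => w we.
  have := subsetP eS w we; rewrite !inE => /orP[/eqP wv|//].
  by rewrite -wv we in vNe.
have /cards1P[w ew] : #|e :\ v| == 1.
  by move: card_e; rewrite (cardsD1 v) ve add1n => -[->].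
have ee : e = [set v; w] by rewrite -(finset.setD1K ve) ew.
have /setD1P[wv we] : w \in e :\ v by rewrite ew inE.
have wS : w \in S.
  by have := subsetP eS w we; rewrite !inE (negbTE wv).
by have := subsetP SW w wS; rewrite !inE ee => /andP[_ /eqP].
Qed.

Lemma set_ramseyP (k r s : nat) :
  0 < s < r -> is_set_ramsey k r s (set_ramsey k r s).
Proof.
move=> /andP[s_gt0 s_ltr]; rewrite /set_ramsey.
have [N HN] : exists N, set_arrow k r s N.
  have [N HN] := multicolor_ramsey (erefl (\sum_(i < r) k)).
  exists N => c cs.
  pose a0 := Ordinal (leq_ltn_trans (leq0n s) s_ltr).
  have [|i [S [_ cardS mono]]] :=
    HN 'I_N [set: 'I_N]%SET (fun e => odflt a0 [pick a in c e]).
    by rewrite cardsT card_ord.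
  exists S; split=> //; exists i => e eS card_e.
  rewrite -(mono e eS card_e); case: pickP => [a //|noa].
  by move: s_gt0; rewrite -(cs e card_e) => /card_gt0P[a]; rewrite [a \in c e]noa.
apply: xgetPex; pose P n := `[< set_arrow k r s n >].
have exP : exists n, P n by exists N; apply/asboolP.
exists (ex_minn exP); case: ex_minnP => m /asboolP Pm minm.
by split=> // M PM; apply: minm; apply/asboolP.
Qed.

(* Main.v *)
Require Import Defs.
From mathcomp Require Import all_classical all_reals all_analysis.
From mathcomp Require Import all_boot all_order all_algebra all_field.
From mathcomp Require Import ring lra zify.

(** Write Q = q^m.  Both quantities have order Q^4, because r lies between
    Q^3 / (2 q) and Q^3 and ((q - 1) r)^(4/3) ~ Q^4.

    Lower bounds.  The Q^2 + 1 points of an elliptic quadric in PG(3, Q) meet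
    every plane in at most Q + 1 points, so evaluating the Q^4 linear forms on
    them gives a code over GF(Q) of length Q^2 + 1 and distance Q^2 - Q
    ([ovoid_code]).  Replacing every symbol by the corresponding word of the
    q-ary simplex code ([simplex_code]), in which all distances are Q / q,
    gives Q^4 words of length r at distance at least s ([max_code_ge]).  A code
    is also a set-coloring: give the edge xy a set of s coordinates in which
    the words x and y differ.  A clique on q + 1 vertices sharing a coordinate
    would need q + 1 letters there, so R(q + 1; r, s) exceeds A_q(r, s)
    ([max_code_lt_set_ramsey]).

    Upper bound for codes.  For words x, y let z(x, y) be the number of
    agreements minus its mean r / q.  As a kernel, z is a sum of r Gram
    matrices, one for each coordinate, and entrywise products of Gram matrices
    are Gram matrices.  So sum z >= 0 and sum z^3 >= 0 over all pairs, and
    sum z^2 is at least what the squares of the single matrices contribute,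
    which is at least sigma^2 N^2 with sigma^2 = r (1 - 1/q) / q.
    Off the diagonal z <= a, where a = (1 - 1/q) r - s = (Q - 1) / q, so the
    cubic (z - a)(z + b)^2 is positive on the diagonal only; summing it over
    all pairs bounds N ([code_size_bound]).  The choice b = sigma^2 / a gives
    N (Q^2 - Q + 2) <= Q^4 (Q^2 + 1) ([max_code_le]).

    Upper bound for the Ramsey number.  In a set-coloring of K_N without a
    common-colored K_{q+1}, each color class is K_{q+1}-free, so by Turan's
    theorem it has at most (1 - 1/q) N^2 / 2 edges.  The s-fold covering of the
    edges makes this almost tight: the total deficiency over the r colors is of
    order Q N^2.  By stability ([turan_stability]) every color class becomes
    q-partite after deleting a number of vertices proportional to its
    deficiency divided by N.  So an average vertex is deleted for O(Q) colors,
    and at least half of them are deleted for O(Q) colors each.  Reading off the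
    q-partitions turns these vertices into words at distance at least s - O(Q)
    ([coloring_code]).  The cubic bound tolerates this loss: it still gives
    O(Q^4) words, since it needs only a = O(Q) and b of order Q^2
    ([loose_code_size]).  The finitely many small Q, for which the constants
    are too large, are absorbed in the final constant ([set_ramsey_le]). *)

Set Implicit Arguments.
Unset Strict Implicit.
Unset Printing Implicit Defensive.

Import Order.TTheory GRing.Theory Num.Theory.
Import numFieldNormedType.Exports.
Local Open Scope ring_scope.

(** * Gram kernels and a cubic bound on codes *)

(** Gram kernels K x y = <f x, f y>, with the feature vector f given by the list
    of its coordinate functions: concatenating lists adds kernels, and pairing
    the entries of two lists multiplies them. *)
Definition gram (R : realFieldType) (T : finType) (K : T -> T -> R) : Prop :=
  exists s : seq (T -> R), forall x y, K x y = \sum_(f <- s) f x * f y.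

Lemma sum_cst (R : realFieldType) (I : finType) (c : R) :
  \sum_(i : I) c = #|I|%:R * c.
Proof. by rewrite sumr_const mulr_natl. Qed.

Lemma gram_sum_ge0 (R : realFieldType) (T : finType) (K : T -> T -> R) :
  gram K -> 0 <= \sum_x \sum_y K x y.
Proof.
move=> [s Ks].
under eq_bigr => x _ do under eq_bigr => y _ do rewrite Ks.
under eq_bigr => x _ do rewrite exchange_big /=.
rewrite exchange_big /=; apply: sumr_ge0 => f _.
under eq_bigr => x _ do rewrite -mulr_sumr.
by rewrite -mulr_suml -expr2 sqr_ge0.
Qed.

Lemma gramM (R : realFieldType) (T : finType) (K L : T -> T -> R) :
  gram K -> gram L -> gram (fun x y => K x y * L x y).
Proof.
move=> [s Ks] [t Lt]; exists [seq (fun x => f x * g x) | f <- s, g <- t] => x y.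
rewrite big_allpairs_dep Ks Lt mulr_suml; apply: eq_bigr => f _.
by rewrite mulr_sumr; apply: eq_bigr => g _; rewrite mulrACA.
Qed.

Lemma gram_sum (R : realFieldType) (T : finType) (J : Type) (r : seq J)
    (P : pred J) (K : J -> T -> T -> R) :
  (forall j, gram (K j)) -> gram (fun x y => \sum_(j <- r | P j) K j x y).
Proof.
move=> gK; elim: r => [|j r [s IHs]].
  by exists [::] => x y; rewrite !big_nil.
case Pj: (P j); last by exists s => x y; rewrite big_cons Pj IHs.
have [t Kt] := gK j; exists (t ++ s) => x y.
by rewrite big_cons Pj big_cat /= IHs Kt.
Qed.

(** Centered so that a uniformly random letter v has mean agreement 0 with u. *)
Definition agreement (R : realFieldType) (F : finType) (u v : F) : R :=
  (u == v)%:R - #|F|%:R^-1.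

(** The feature vectors are the indicators of the letters, projected
    orthogonally to the all-one vector. *)
Lemma gram_agreement (R : realFieldType) (T F : finType) (w : T -> F) :
  (0 < #|F|)%N -> gram (fun x y => agreement R (w x) (w y)).
Proof.
move=> F0; pose f (c : F) x : R := (w x == c)%:R - #|F|%:R^-1.
have q0 : #|F|%:R != 0 :> R by rewrite pnatr_eq0 -lt0n.
have sum_delta (u : F) : \sum_c (u == c)%:R = 1 :> R.
  rewrite (bigD1 u) //= eqxx big1 ?addr0 // => c.
  by rewrite eq_sym => /negbTE ->.
exists [seq f c | c <- enum F] => x y; rewrite big_map big_enum /=.
transitivity (\sum_c (((w x == c)%:R * (w y == c)%:R
   - #|F|%:R^-1 * ((w x == c)%:R + (w y == c)%:R)) + #|F|%:R^-1 ^+ 2) : R); last first.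
  by apply: eq_bigr => c _; rewrite /f; ring.
rewrite big_split sumrB /= -mulr_sumr big_split /= !sum_delta sum_cst.
rewrite (bigD1 (w x)) //= eqxx big1 => [|c]; last first.
  by rewrite eq_sym => /negbTE ->; rewrite mul0r.
rewrite /agreement (eq_sym (w y)) /=.
by field.
Qed.

Definition excess (R : realFieldType) (I F : finType) (u v : I -> F) : R :=
  \sum_i agreement R (u i) (v i).

Lemma excess_hamming (R : realFieldType) (I F : finType) (u v : I -> F) :
  excess R u v
  = (1 - #|F|%:R^-1) * #|I|%:R - #|[set i | u i != v i]|%:R.
Proof.
rewrite /excess sumrB sum_cst.
have -> : \sum_i (u i == v i)%:R = #|I|%:R - #|[set i | u i != v i]|%:R :> R.
  have -> : \sum_i (u i == v i)%:R = #|[set i | u i == v i]|%:R :> R.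
    rewrite -sum1dep_card natr_sum [RHS]big_mkcond /=.
    by apply: eq_bigr => i _; case: (_ == _).
  rewrite -(cardsC [set i | u i == v i]) natrD.
  have -> : ~: [set i | u i == v i] = [set i | u i != v i].
    by apply/setP => i; rewrite !inE.
  by rewrite addrK.
ring.
Qed.

(** The left-hand side is at most what the diagonal terms of the squared sum over the
    coordinates contribute; the mixed terms form a Gram kernel. *)
Lemma sum_excess_sqr_ge (R : realFieldType) (T I F : finType) (w : T -> I -> F) :
  (1 < #|F|)%N ->
  (1 - #|F|%:R^-1) * #|I|%:R / #|F|%:R * #|T|%:R ^+ 2
    <= \sum_x \sum_y excess R (w x) (w y) ^+ 2.
Proof.
move=> F1; have F0 := ltnW F1; set q : R := #|F|%:R.
have q0 : q != 0 by rewrite pnatr_eq0 -lt0n.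
pose M i x y := agreement R (w x i) (w y i).
pose off x y := \sum_i M i x y * \sum_(i' | i' != i) M i' x y.
have gM i : gram (M i) by apply: (@gram_agreement R T F (fun x => w x i)).
have off0 : 0 <= \sum_x \sum_y off x y.
  apply: gram_sum_ge0; apply: gram_sum => i.
  by apply: gramM => //; apply: gram_sum.
(* z^2 = (1 - 2 / q) z + (1 - 1 / q) / q for both values of an agreement. *)
have diag i : (1 - q^-1) / q * #|T|%:R ^+ 2 <= \sum_x \sum_y M i x y ^+ 2.
  have -> : \sum_x \sum_y M i x y ^+ 2 =
     (1 - 2 / q) * (\sum_x \sum_y M i x y) + (1 - q^-1) / q * #|T|%:R ^+ 2.
    rewrite mulr_sumr.
    transitivity (\sum_x ((1 - 2 / q) * (\sum_y M i x y) + (1 - q^-1) / q * #|T|%:R)).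
      apply: eq_bigr => x _; rewrite mulr_sumr.
      transitivity (\sum_y ((1 - 2 / q) * M i x y + (1 - q^-1) / q)).
        apply: eq_bigr => y _; rewrite /M /agreement -/q.
        by case: (_ == _); rewrite /=; field.
      by rewrite big_split /= sum_cst [X in _ + X]mulrC.
    by rewrite big_split /= sum_cst; congr (_ + _); ring.
  rewrite lerDr.
  apply: mulr_ge0; last exact: gram_sum_ge0.
  by rewrite subr_ge0 ler_pdivrMr ?mul1r ?ler_nat // ltr0n.
have -> : \sum_x \sum_y excess R (w x) (w y) ^+ 2 =
   \sum_i (\sum_x \sum_y M i x y ^+ 2) + \sum_x \sum_y off x y.
  rewrite [X in _ = X + _]exchange_big /= -big_split /=; apply: eq_bigr => x _.
  rewrite [X in _ = X + _]exchange_big /= -big_split /=; apply: eq_bigr => y _.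
  rewrite /off -big_split /= expr2 {1}/excess mulr_suml; apply: eq_bigr => i _.
  by rewrite -/(M i x y) /excess (bigD1 i) //= -/(M i x y) mulrDr -expr2.
rewrite -[X in X <= _]addr0 lerD //.
apply: le_trans (_ : \sum_(i : I) (1 - q^-1) / q * #|T|%:R ^+ 2 <= _);
  last exact: ler_sum.
by rewrite sum_cst le_eqVlt; apply/orP; left; apply/eqP; ring.
Qed.

(** A linear programming bound with the cubic (z - a)(z + b)^2 in the excess z of
    agreements.  The hypothesis 2 a <= b makes the coefficients of z and z^2
    nonnegative, so that lower bounds on the moments of z give a lower bound on
    the sum of the cubic. *)
Lemma code_size_bound (R : realFieldType) (T I F : finType) (w : T -> I -> F)
    (mu a b : R) :
  (1 < #|F|)%N -> (0 < #|T|)%N -> mu = (1 - #|F|%:R^-1) * #|I|%:R ->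
  0 <= a -> 2 * a <= b ->
  (forall x y, x != y -> mu - a <= #|[set i | w x i != w y i]|%:R) ->
  #|T|%:R * ((2 * b - a) * (mu / #|F|%:R) - a * b ^+ 2) <= (mu - a) * (mu + b) ^+ 2.
Proof.
move=> F1 T0 mu_def a0 ab far.
pose S x y := excess R (w x) (w y).
have T0' : 0 < #|T|%:R :> R by rewrite ltr0n.
have S_diag x : S x x = mu.
  rewrite /S excess_hamming mu_def (_ : [set i | _] = set0) ?cards0 ?subr0 //.
  by apply/setP => i; rewrite !inE eqxx.
have S_off x y : x != y -> S x y <= a.
  by move=> /far; rewrite /S excess_hamming -mu_def lerBlDr lerBlDl addrC.
have F0 := ltnW F1; have gS : gram S by apply: gram_sum => i;
  apply: (@gram_agreement R T F (fun x => w x i)).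
have S1 := gram_sum_ge0 gS.
have S3 : 0 <= \sum_x \sum_y S x y ^+ 3.
  by apply: (gram_sum_ge0 (gramM gS (gramM gS gS))).
have S2 := sum_excess_sqr_ge R w F1.
rewrite -mu_def in S2.
(* The cubic is nonpositive at the off-diagonal values, which are at most a. *)
have upper : \sum_x \sum_y (S x y - a) * (S x y + b) ^+ 2
    <= #|T|%:R * ((mu - a) * (mu + b) ^+ 2).
  rewrite -sum_cst; apply: ler_sum => x _.
  rewrite (bigD1 x) //= S_diag gerDl; apply: sumr_le0 => y yx.
  by rewrite mulr_le0_ge0 ?sqr_ge0 // subr_le0 S_off // eq_sym.
have expand : \sum_x \sum_y (S x y - a) * (S x y + b) ^+ 2 =
    \sum_x \sum_y S x y ^+ 3 + (2 * b - a) * (\sum_x \sum_y S x y ^+ 2)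
    + (b * (b - 2 * a)) * (\sum_x \sum_y S x y) - a * b ^+ 2 * #|T|%:R ^+ 2.
  have -> : a * b ^+ 2 * #|T|%:R ^+ 2 = \sum_(x : T) \sum_(y : T) a * b ^+ 2.
    by rewrite !sum_cst; ring.
  rewrite !mulr_sumr -!big_split -sumrB /=; apply: eq_bigr => x _.
  rewrite !mulr_sumr -!big_split -sumrB /=; apply: eq_bigr => y _.
  ring.
have b0 : 0 <= b by lra.
rewrite -(ler_pM2l T0'); apply: le_trans upper; rewrite expand.
have := ler_wpM2l (_ : 0 <= 2 * b - a) S2 => /(_ ltac:(lra)).
have : 0 <= b * (b - 2 * a) * (\sum_x \sum_y S x y).
  by rewrite !mulr_ge0 // subr_ge0.
move=> h1 h2; rewrite -/S.
have -> : #|T|%:R * (#|T|%:R * ((2 * b - a) * (mu / #|F|%:R) - a * b ^+ 2))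
 = (2 * b - a) * (mu / #|F|%:R * #|T|%:R ^+ 2) - a * b ^+ 2 * #|T|%:R ^+ 2 by ring.
rewrite lerB //; lra.
Qed.

(** * A code from an elliptic quadric *)

(** Built by recursion on the dimension: over a word of the previous code, the
    next one has all translates c + l * a, for l in F, and the letter a itself.
    If a changes, exactly one translate agrees at each old coordinate; this
    keeps all distances equal. *)
Lemma simplex_code (F : finFieldType) (m : nat) :
  exists (T I : finType) (w : T -> I -> F),
    [/\ #|T| = (#|F| ^ m)%N, (#|I| * (#|F| - 1) + 1)%N = (#|F| ^ m)%N &
        forall x y, x != y -> (#|[set i | w x i != w y i]| * #|F|)%N = (#|F| ^ m)%N].
Proof.
elim: m => [|m [T [I [w [cardT cardI dist]]]]].
  exists unit, void, (fun _ _ => 0); split; last by move=> [] [].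
    by rewrite card_unit.
  by rewrite card_void.
have F0 : (0 < #|F|)%N by apply/card_gt0P; exists 0.
exists (T * F)%type, (option (I * F)).
exists (fun u i => if i is Some il then w u.1 il.1 + il.2 * u.2 else u.2).
split.
- by rewrite card_prod cardT expnSr.
- rewrite card_option card_prod -addn1 expnSr -cardI.
  by case: #|F| F0 => // q' _; rewrite subn1 /=; ring.
move=> [x a] [y b] /=.
have [<-{b}|ab] := eqVneq a b => xy; set D := [set i | _].
  have {}xy : x != y by apply: contraNneq xy => ->.
  have -> : D = Some @: setX [set i | w x i != w y i] [set: F].
    apply/setP => -[[i l]|]; last first.
      by rewrite inE eqxx; apply/esym/negbTE/negP => /imsetP[].
    rewrite mem_imset; last exact: Some_inj.
    by rewrite !inE /= andbT (inj_eq (addIr _)).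
  rewrite card_imset; last exact: Some_inj.
  by rewrite cardsX cardsT -mulnA mulnA dist // expnSr.
pose root_at i := (w y i - w x i) / (a - b).
have agree i l : (w x i + l * a == w y i + l * b) = (l == root_at i).
  have ab0 : a - b != 0 by rewrite subr_eq0.
  rewrite /root_at -[RHS](inj_eq (mulIf ab0)) divfK //.
  rewrite -subr_eq0 -[in RHS]subr_eq0; congr (_ == 0); ring.
have cardDC : #|~: D| = #|I|.
  have -> : ~: D = [set Some (i, root_at i) | i in I].
    apply/setP => -[[i l]|]; last first.
      by rewrite !inE ab; apply/esym/negbTE/negP => /imsetP[].
    rewrite !inE negbK agree /=; apply/eqP/imsetP => [->|[j _ [-> ->]] //].
    by exists i.
  by rewrite card_imset // => i j [].
have cardD : (#|D| + #|I| = (#|I| * #|F|).+1)%N.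
  by rewrite -[X in (_ + X)%N = _]cardDC cardsC card_option card_prod.
have -> : #|D| = (#|I| * (#|F| - 1) + 1)%N by have := leq_pmulr #|I| F0;
  rewrite mulnBr muln1; lia.
by rewrite cardI expnSr.
Qed.

Lemma card_roots (F : finFieldType) (p : {poly F}) (n : nat) :
  p != 0 -> (size p <= n.+1)%N -> (#|[set x | root p x]| <= n)%N.
Proof.
move=> p0 sp; rewrite -ltnS; apply: leq_trans sp; rewrite cardE.
apply: max_poly_roots (enum_uniq _) => //.
by apply/allP => x; rewrite mem_enum inE.
Qed.

(** Let F have order Q^2 and let K be its subfield of order Q.  The points (1, x, N x)
    for x in F, with N the norm, together with (0, 0, 1), form an elliptic
    quadric in the space K * F * K over K, and a form on this space is
    (al, be, ga) |-> al + Tr (be * x) + ga * N x.  Along the affine points such a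
    form is a polynomial in x of degree at most Q + 1, or at most Q when it
    vanishes at infinity; so it has at most Q + 1 zeros. *)
Lemma ovoid_code (p n : nat) : prime p -> (0 < n)%N -> let Q := (p ^ n)%N in
  exists (T I K : finType) (w : T -> I -> K),
    [/\ #|T| = (Q ^ 4)%N, #|I| = (Q ^ 2 + 1)%N, #|K| = Q &
        forall x y, x != y -> (#|[set i | w x i == w y i]| <= Q + 1)%N].
Proof.
move=> pr_p n0 Q.
have Q1 : (1 < Q)%N by apply: leq_trans (prime_gt1 pr_p) (leq_pexp2l _ n0);
  apply: prime_gt0.
have n20 : (0 < 2 * n)%N by rewrite muln_gt0.
have [F charF cardF] := pPrimePowerField pr_p n20.
have QF : (Q ^ 2)%N = #|F| by rewrite cardF mulnC expnM.
have frobD x y : (x + y) ^+ Q = x ^+ Q + y ^+ Q :> F.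
  by apply: exprDn_pchar; rewrite pnatX pnatE // charF.
have frobB x y : (x - y) ^+ Q = x ^+ Q - y ^+ Q :> F.
  by apply/eqP; rewrite eq_sym subr_eq -frobD subrK.
have frob2 x : (x ^+ Q) ^+ Q = x :> F by rewrite -exprM mulnn QF expf_card.
pose K : finType := {x : F | x ^+ Q == x}.
have Kfix (c : K) : val c ^+ Q = val c by apply/eqP/(valP c).
have sfix (c : K) : sval c ^+ Q = sval c := Kfix c.
have tr_fix (x : F) : (x + x ^+ Q) ^+ Q == x + x ^+ Q by rewrite frobD frob2 addrC.
have zero_fix : (0 : F) ^+ Q == 0 by rewrite expr0n; case: (Q) Q1.
pose K0 : K := exist _ 0 zero_fix.
have toKE (x : F) : x ^+ Q == x -> val (insubd K0 x) = x.
  by move=> hx; rewrite val_insubd hx.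
have sizeXQ (c : F) (d : F) : (size ('X^Q + (d *: 'X + c%:P))) = Q.+1.
  rewrite size_polyDl ?size_polyXn //.
  apply: leq_ltn_trans (size_polyD _ _) _; rewrite gtn_max.
  rewrite (leq_ltn_trans (size_scale_leq _ _)) ?size_polyX //=.
  by rewrite (leq_ltn_trans (size_polyC_leq1 _)) ?ltnS ?(ltnW Q1).
(* K consists of the roots of X^Q - X, and the fibers of the trace from F
   onto K are root sets of polynomials of degree Q. *)
have cardK : #|K| = Q.
  apply/eqP; rewrite eqn_leq; apply/andP; split.
    rewrite -(card_imset xpredT val_inj) /=.
    apply: leq_trans (@card_roots F ('X^Q + ((-1) *: 'X + 0%:P)) Q _ _).
    - apply/subset_leq_card/subsetP => _ /imsetP[x _ ->].
      by rewrite inE rootE !hornerD hornerZ hornerX hornerC hornerXn Kfix mulN1r addr0 subrr.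
    - by rewrite -size_poly_eq0 sizeXQ.
    - by rewrite sizeXQ.
  have : (#|F| <= #|K| * Q)%N.
    pose f (x : F) : K := insubd K0 (x + x ^+ Q).
    rewrite -sum1_card (partition_big f xpredT) //=.
    rewrite -sum_nat_const; apply: leq_sum => c _; rewrite sum1dep_card.
    apply: leq_trans (@card_roots F ('X^Q + (1 *: 'X + (- val c)%:P)) Q _ _).
    - apply/subset_leq_card/subsetP => x; rewrite !inE /= => /eqP <-.
      rewrite rootE !hornerD hornerZ hornerX hornerC hornerXn toKE //; apply/eqP; ring.
    - by rewrite -size_poly_eq0 sizeXQ.
    - by rewrite sizeXQ.
  by rewrite -QF leq_pmul2r // ltnW.
pose val_at (u : F * F * F) (x : F) :=
  u.1.1 + (u.1.2 * x + (u.1.2 * x) ^+ Q) + u.2 * (x * x ^+ Q).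
pose raw (u : K * F * K) : F * F * F := (val u.1.1, u.1.2, val u.2).
have val_fix u x : val_at (raw u) x ^+ Q == val_at (raw u) x.
  rewrite /val_at /= !frobD [(sval u.2 * _) ^+ Q]exprMn !sfix frob2 (addrC ((_ * _) ^+ Q)).
  by rewrite [(x * _) ^+ Q]exprMn frob2 (mulrC (x ^+ Q)).
pose w (u : K * F * K) (i : option F) : K :=
  if i is Some x then insubd K0 (val_at (raw u) x) else u.2.
exists (K * F * K)%type, (option F), K, w; split => //.
- by rewrite !card_prod cardK -QF; ring.
- by rewrite card_option -QF addn1.
move=> u v uv.
pose al := sval u.1.1 - sval v.1.1; pose be := u.1.2 - v.1.2.
pose ga := sval u.2 - sval v.2.
pose P : {poly F} := (al%:P + be *: 'X) + ((be ^+ Q) *: 'X^Q + ga *: 'X^(Q.+1)).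
have agreeE x : (w u (Some x) == w v (Some x)) = root P x.
  rewrite /w -(inj_eq val_inj) !toKE // -subr_eq0 rootE; congr (_ == 0).
  rewrite /P !hornerD !hornerZ !hornerXn hornerX hornerC /val_at /=.
  rewrite !exprMn (exprS x Q) /be frobB /al /ga; ring.
have coefP (k : nat) : P`_k = (if k == 0%N then al else 0) + (if k == 1%N then be else 0)
   + (if k == Q then be ^+ Q else 0) + (if k == Q.+1 then ga else 0).
  rewrite !coefE !addrA; congr (_ + _ + _ + _);
    by case: (_ == _); rewrite /= ?mulr1 ?mulr0.
have sizeP : (size P <= (if ga == 0%R then Q.+1 else Q.+2))%N.
  apply/leq_sizeP => k hk; rewrite (coefP k).
  have [kQ|kQ] := eqVneq k Q.+1.
    move: hk; rewrite kQ; have [->|_] := eqVneq ga 0; last by rewrite ltnn.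
    move=> _; rewrite !ifN ?addr0 //; lia.
  have : (Q < k)%N by move: hk; case: ifP; lia.
  move=> hk'; rewrite !ifN ?addr0 //; lia.
have P0 : P != 0.
  apply: contraNneq uv => P0.
  have c (k : nat) : P`_k = 0 by rewrite P0 coef0.
  have ga0 : ga = 0.
    have := c Q.+1; rewrite coefP eqxx [Q.+1 == Q]gtn_eqF // [Q.+1 == 0%N]gtn_eqF //.
    by rewrite [Q.+1 == 1%N]gtn_eqF 1?ltnW // !add0r.
  have be0 : be = 0.
    have := c 1%N; rewrite coefP eqxx [1%N == 0%N]gtn_eqF // [1%N == Q]ltn_eqF //.
    by rewrite [1%N == Q.+1]ltn_eqF 1?ltnW // !addr0 add0r.
  have al0 : al = 0.
    have := c 0%N; rewrite coefP eqxx [0%N == 1%N]ltn_eqF // [0%N == Q]ltn_eqF 1?ltnW //.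
    by rewrite [0%N == Q.+1]ltn_eqF // !addr0.
  case: u v @al @be @ga {agreeE coefP sizeP P0 c P} al0 be0 ga0 => [[a b] g] [[a' b'] g'] /=.
  by move=> /eqP + /eqP + /eqP;
    rewrite !subr_eq0 => /eqP/val_inj -> /eqP -> /eqP/val_inj ->.
have -> : [set i | w u i == w v i] =
   (if ga == 0 then [set None] else set0) :|: Some @: [set x | root P x].
  apply/setP => -[x|].
    rewrite inE agreeE in_setU mem_imset; last exact: Some_inj.
    by rewrite inE; case: (ga == 0); rewrite !inE.
  rewrite inE in_setU /= [X in _ || X](_ : _ = false) ?orbF; last first.
    by apply/negbTE/negP => /imsetP[].
  rewrite -(inj_eq val_inj) -subr_eq0 -/ga.
  by case: (ga == 0); rewrite !inE.
apply: leq_trans (leq_card_setU _ _) _.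
rewrite card_imset; last exact: Some_inj.
move: sizeP; have [ga0|ga0] := eqVneq ga 0 => sizeP.
  by rewrite cards1 addnC leq_add2r; apply: card_roots.
by rewrite cards0 add0n addn1; apply: card_roots.
Qed.

(** A coordinate where the outer words differ contributes at least d
    differences, since distinct outer symbols become distinct inner words. *)
Lemma concatenated_code (T I K S J F : finType) (w : T -> I -> K) (e : S -> J -> F)
    (D d : nat) :
  #|K| = #|S| ->
  (forall x y, x != y -> D <= #|[set i | w x i != w y i]|)%N ->
  (forall s t, s != t -> d <= #|[set j | e s j != e t j]|)%N ->
  exists v : T -> I * J -> F,
    forall x y, x != y -> (D * d <= #|[set ij | v x ij != v y ij]|)%N.
Proof.
move=> cardKS farw fare.
pose g (a : K) : S := enum_val (cast_ord cardKS (enum_rank a)).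
have g_inj : injective g.
  by move=> a b /enum_val_inj/cast_ord_inj/enum_rank_inj.
exists (fun x ij => e (g (w x ij.1)) ij.2) => x y xy.
set X := [set i | w x i != w y i].
apply: (@leq_trans (\sum_(i in X) d));
  first by rewrite sum_nat_const leq_mul2r farw ?orbT.
apply: (@leq_trans (\sum_(i in X) #|[set j | e (g (w x i)) j != e (g (w y i)) j]|)).
  by apply: leq_sum => i; rewrite inE => xi; apply: fare; rewrite (inj_eq g_inj).
under eq_bigr => i _ do rewrite -sum1dep_card.
rewrite -sum1dep_card pair_big_dep /=.
apply: eq_leq; apply: eq_bigl => -[i j] /=; rewrite inE /=.
by case: eqVneq => //= ->; rewrite eqxx.
Qed.

Lemma code_le_max_code (T I F : finType) (w : T -> I -> F) (q r d : nat) :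
  #|F| = q -> #|I| = r -> (0 < d)%N ->
  (forall x y, x != y -> d <= #|[set i | w x i != w y i]|)%N ->
  (#|T| <= max_code q r d)%N.
Proof.
move=> <- <- d0 far.
pose c x : {ffun 'I_#|I| -> 'I_#|F|} := [ffun i => enum_rank (w x (enum_val i))].
have hamE x y : hamming (c x) (c y) = #|[set i | w x i != w y i]|.
  rewrite /hamming -(card_imset _ (@enum_val_inj _ I)); apply: eq_card => i.
  rewrite inE; apply/imsetP/idP => [[k]|xy].
    by rewrite inE !ffunE (inj_eq enum_rank_inj) => ? ->.
  by exists (enum_rank i);
    rewrite ?enum_rankK // inE !ffunE !enum_rankK (inj_eq enum_rank_inj).
have c_inj : injective c.
  move=> x y cxy; apply/eqP; apply: contraT => /far; rewrite -hamE cxy.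
  have -> : hamming (c y) (c y) = 0%N.
    by apply/eqP; rewrite cards_eq0; apply/eqP/setP => i; rewrite !inE eqxx.
  by rewrite leqn0 => /eqP d00; rewrite d00 in d0.
have dC : min_dist_geq d (c @: [set: T]).
  apply/forall_inP => _ /imsetP[x _ ->]; apply/forall_inP => _ /imsetP[y _ ->].
  by apply/implyP; rewrite (inj_eq c_inj) hamE; apply: far.
rewrite -cardsT -(card_imset _ c_inj).
exact: (@leq_bigmax_cond _ (min_dist_geq d) (fun C : {set _} => #|C|) _ dC).
Qed.

Lemma par_r_nat (q m : nat) : (1 < q)%N ->
  (par_r q m * (q - 1))%N = (((q ^ m) ^ 2 + 1) * (q ^ m - 1))%N.
Proof.
move=> q1; rewrite /par_r divnK // dvdn_mull //.
by rewrite !subn1 predn_exp dvdn_mulr.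
Qed.

Lemma par_j_nat (q m : nat) : (1 < q)%N -> (par_j q m * (q - 1))%N = (q ^ m - 1)%N.
Proof. by move=> q1; rewrite /par_j divnK // !subn1 predn_exp dvdn_mulr. Qed.

Lemma par_s_nat (q m : nat) : (0 < m)%N ->
  (par_s q m * q)%N = ((q ^ m) ^ 2 * (q ^ m - 1))%N.
Proof.
move=> m0; rewrite /par_s divnK //; apply: dvdn_mulr.
by apply: dvdn_exp => //; apply: dvdn_exp.
Qed.

Lemma prime_power_gt1 (q : nat) : prime_power q -> (1 < q)%N.
Proof.
move=> [p [n [pr_p n0 ->]]].
by apply: leq_trans (leq_pexp2l (prime_gt0 pr_p) n0); apply: prime_gt1.
Qed.

Lemma max_code_ge (q m : nat) : prime_power q -> (0 < m)%N ->
  ((q ^ m) ^ 4 <= max_code q (par_r q m) (par_s q m))%N.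
Proof.
move=> hq m0; have q1 := prime_power_gt1 hq; have [p [n [pr_p n0 qE]]] := hq.
have [F _ cardF] := pPrimePowerField pr_p n0; rewrite -qE in cardF.
have nm0 : (0 < n * m)%N by rewrite muln_gt0 n0.
have [T [I [K [w [cardT cardI cardK agree]]]]] := ovoid_code pr_p nm0.
rewrite expnM -qE in cardT cardI cardK agree.
have [S [J [e [cardS cardJ dist]]]] := simplex_code F m.
rewrite cardF in cardS cardJ dist.
set Q := (q ^ m)%N in cardT cardI cardK agree cardS cardJ dist *.
have Q1 : (1 < Q)%N by apply: leq_trans (leq_pexp2l (ltnW q1) m0).
have QE : (q ^ m.-1 * q)%N = Q by rewrite -expnSr prednK.
have farw x y : x != y -> (Q * (Q - 1) <= #|[set i | w x i != w y i]|)%N.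
  move=> /agree; have := cardsC [set i | w x i == w y i]; rewrite cardI.
  have -> : ~: [set i | w x i == w y i] = [set i | w x i != w y i].
    by apply/setP => i; rewrite !inE.
  rewrite mulnBr; lia.
have fare s t : s != t -> (q ^ m.-1 <= #|[set j | e s j != e t j]|)%N.
  by move=> /dist; rewrite -QE => /eqP; rewrite (eqn_pmul2r (ltnW q1)) => /eqP ->.
have [v far] := concatenated_code (etrans cardK (esym cardS)) farw fare.
have sE : (Q * (Q - 1) * q ^ m.-1)%N = par_s q m.
  apply/eqP; rewrite -(eqn_pmul2r (ltnW q1)) par_s_nat // -/Q -mulnA QE; apply/eqP;
    ring.
rewrite -cardT; apply: (@code_le_max_code _ _ _ v _ _ _ cardF).
- apply/eqP; rewrite card_prod -(eqn_pmul2r (_ : 0 < q - 1)%N) ?subn_gt0 //.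
  rewrite par_r_nat // -/Q cardI -mulnA; apply/eqP; congr (_ * _)%N; lia.
- rewrite -sE !muln_gt0 subn_gt0 Q1 expn_gt0 ltnW // ltnW //.
- by move=> x y /far; rewrite sE.
Qed.

(** * Turan's theorem with stability *)

Local Open Scope nat_scope.

Definition clique (T : finType) (e : rel T) (S : {set T}) : Prop :=
  {in S &, forall x y, x != y -> e x y}.

Definition clique_free (T : finType) (e : rel T) (k : nat) (W : {set T}) : Prop :=
  forall S : {set T}, S \subset W -> clique e S -> #|S| <> k.

Definition nbrs (T : finType) (e : rel T) (W : {set T}) (x : T) : {set T} :=
  [set y in W | e x y].

(** Twice the number of edges inside W. *)
Definition degree_sum (T : finType) (e : rel T) (W : {set T}) : nat :=
  \sum_(x in W) #|nbrs e W x|.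

Lemma clique_extend (T : finType) (e : rel T) (S : {set T}) (x : T) :
  symmetric e -> clique e S -> {in S, forall y, e x y} -> clique e (x |: S).
Proof.
move=> esym cS xS y z; rewrite !inE.
move=> /predU1P[->|yS] /predU1P[->|zS] => [|_|_|]; first by rewrite eqxx.
- exact: xS.
- by rewrite esym; apply: xS.
- exact: cS.
Qed.

Lemma double_count (T : finType) (e : rel T) (A B : {set T}) :
  symmetric e -> \sum_(x in A) #|nbrs e B x| = \sum_(y in B) #|nbrs e A y|.
Proof.
move=> esym; rewrite (eq_bigr (fun x => \sum_(y in B) e x y)) => [|x _]; last first.
  by rewrite -sum1dep_card big_mkcondr; apply: eq_bigr => y _; case: (e x y).
rewrite exchange_big; apply: eq_bigr => y _ /=.
rewrite -sum1dep_card big_mkcondr; apply: eq_bigr => x _.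
by rewrite esym; case: (e y x).
Qed.

Lemma card_nbrsD (T : finType) (e : rel T) (W A : {set T}) (x : T) :
  A \subset W -> #|nbrs e W x| = #|nbrs e A x| + #|nbrs e (W :\: A) x|.
Proof.
move=> AW; rewrite -(cardsID A (nbrs e W x)); congr (_ + _).
  by apply: eq_card => y; rewrite !inE; have := subsetP AW y;
    case: (y \in A) => [->|] //=; rewrite ?andbT ?andbF.
by apply: eq_card => y; rewrite !inE andbA.
Qed.

(** Erdos's argument: if v has maximum degree, its neighborhood A is free of cliques
    one size smaller, and all edges not inside A meet W :\: A, whose vertices
    have degree at most #|A|. *)
Lemma turan (T : finType) (e : rel T) (k : nat) (W : {set T}) :
  symmetric e -> irreflexive e -> clique_free e k.+2 W ->
  k.+1 * degree_sum e W <= k * #|W| ^ 2.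
Proof.
move=> esym eirr; elim: k W => [|k IHk] W freeW.
  rewrite mul0n mul1n leqn0 /degree_sum; apply/eqP/big1 => x xW.
  apply/eqP; rewrite cards_eq0; apply/eqP/setP => y; rewrite !inE.
  apply/negP => /andP[yW exy].
  have xy : x != y by apply: contraTneq exy => ->; rewrite eirr.
  apply: (freeW [set x; y]); last by rewrite cards2 xy.
    by apply/subsetP => z; rewrite !inE => /orP[] /eqP ->.
  apply: clique_extend => // [z t|z]; rewrite !inE; last by move/eqP ->.
  by move=> /eqP -> /eqP ->; rewrite eqxx.
have [->|[w wW]] := set_0Vmem W.
  by rewrite /degree_sum big_set0 muln0.
case: (arg_maxnP (fun x => #|nbrs e W x|) wW) => v /= vW vmax.
have {}vW : v \in W by [].
set A := nbrs e W v; have AW : A \subset W.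
  by apply/subsetP => y; rewrite inE => /andP[].
have freeA : clique_free e k.+2 A.
  move=> S SA cS cardS.
  have vS : v \notin S.
    by apply/negP => /(subsetP SA); rewrite inE eirr andbF.
  apply: (freeW (v |: S)); last by rewrite cardsU1 vS cardS.
    by rewrite subUset sub1set vW (subset_trans SA AW).
  by apply: clique_extend => // y /(subsetP SA); rewrite inE => /andP[].
have := IHk A freeA.
have cardD : #|W| = #|A| + #|W :\: A| by rewrite -(cardsID A W) (setIidPr AW).
have low : \sum_(x in W :\: A) #|nbrs e W x| <= #|W :\: A| * #|A|.
  rewrite -sum_nat_const; apply: leq_sum => x; rewrite inE => /andP[_ xW].
  exact: vmax.
have : degree_sum e W <= degree_sum e A + 2 * (#|W :\: A| * #|A|).
  rewrite {1}/degree_sum (big_setID A) /= (setIidPr AW) mul2n -addnn addnA.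
  apply: leq_add => //; rewrite /degree_sum.
  rewrite (eq_bigr (fun x => #|nbrs e A x| + #|nbrs e (W :\: A) x|)); last first.
    by move=> x _; rewrite (card_nbrsD _ _ AW).
  rewrite big_split /= leq_add2l double_count //; apply: leq_trans low.
  by apply: leq_sum => x _; rewrite (card_nbrsD _ _ AW) leq_addr.
move: (degree_sum e W) (degree_sum e A) => D D'.
rewrite cardD; move: #|A| #|W :\: A| => a b hD IH.
(* The remaining inequality is ((k.+1) (a + b) - (k.+2) a)^2 >= 0. *)
have sq := nat_Cauchy (k.+1 * (a + b)) (k.+2 * a).
rewrite -(leq_pmul2l (ltn0Sn k)).
have h1 : k.+1 * D <= k * a ^ 2 + 2 * (k.+1 * (b * a)).
  apply: leq_trans (leq_mul (leqnn _) hD) _.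
  by rewrite mulnDr (mulnCA k.+1 2) leq_add2r.
have h2 := leq_mul (leqnn k.+2) h1.
rewrite mulnCA; apply: leq_trans h2 _.
have -> : k.+1 * (k.+1 * (a + b) ^ 2) = (k.+1 * (a + b)) ^ 2 by ring.
rewrite -(leq_add2r ((k.+2 * a) ^ 2)); apply: leq_trans sq.
by apply/eq_leq; ring.
Qed.

(** When a vertex has to be picked in U k, fewer than #|X| + size ks vertices have
    been chosen, and each of them excludes at most eta candidates. *)
Lemma greedy_clique (T : finType) (J : eqType) (e : rel T) (U : J -> {set T})
    (eta : nat) (ks : seq J) (X : {set T}) :
  symmetric e -> irreflexive e -> uniq ks -> clique e X ->
  (forall k x, k \in ks -> x \in X -> #|U k :\: nbrs e (U k) x| <= eta) ->
  (forall k l x, k \in ks -> l \in ks -> k != l -> x \in U k ->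
     #|U l :\: nbrs e (U l) x| <= eta) ->
  (forall k, k \in ks -> (#|X| + size ks).-1 * eta < #|U k|) ->
  exists Y : {set T}, [/\ clique e Y, #|Y| = #|X| + size ks &
    forall y, y \in Y -> y \in X \/ exists2 k, k \in ks & y \in U k].
Proof.
move=> esym eirr; elim: ks X => [|k ks IH] X /=.
  by move=> _ cX _ _ _; exists X; split; rewrite ?addn0 //; left.
move=> /andP[kNks uks] cX nX nU large.
have [a aU aX] : exists2 a, a \in U k & {in X, forall x, e a x}.
  have : ~~ (U k \subset \bigcup_(x in X) (U k :\: nbrs e (U k) x)).
    apply: contraL (large k (mem_head _ _)) => /subset_leq_card sub.
    rewrite -leqNgt; apply: leq_trans sub _.
    apply: leq_trans (_ : \sum_(x in X) #|U k :\: nbrs e (U k) x| <= _).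
      elim/big_rec2: _ => [|x n S _ le]; first by rewrite cards0.
      by apply: leq_trans (leq_card_setU _ _) _; rewrite leq_add2l.
    apply: leq_trans (_ : \sum_(x in X) eta <= _).
      by apply: leq_sum => x xX; apply: nX; rewrite ?mem_head.
    by rewrite sum_nat_const addnS /= leq_mul2r leq_addr orbT.
  case/subsetPn => a aU aN; exists a => // x xX.
  apply: contraNT aN => nea; apply/bigcupP; exists x => //.
  by rewrite !inE aU esym (negbTE nea).
have aNX : a \notin X by apply/negP => /aX; rewrite eirr.
have [|l x lks|l j x lks jks|l lks|Y [cY cardY inY]] := IH (a |: X) uks.
- exact: clique_extend.
- rewrite !inE => /predU1P[->|xX]; last by apply: nX; rewrite // inE lks orbT.
  apply: (nU k l a) => //; rewrite ?inE ?eqxx ?lks ?orbT //.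
  by apply: contraNneq kNks => ->.
- by apply: nU; rewrite inE ?lks ?jks orbT.
- by have := large l; rewrite cardsU1 aNX inE lks orbT addnS add1n => /(_ isT).
exists Y; split; rewrite ?cardY ?cardsU1 ?aNX ?addnS //.
move=> y /inY[|[l lks yl]]; last by right; exists l; rewrite // inE lks orbT.
by rewrite !inE => /predU1P[->|yX]; [right; exists k; rewrite ?mem_head | left].
Qed.

Lemma card_setDU (T : finType) (V A B N : {set T}) :
  A \subset V -> B \subset V -> [disjoint A & B] ->
  #|A :\: N| + #|B :\: N| <= #|V :\: N|.
Proof.
move=> AV BV dAB.
have -> : #|A :\: N| + #|B :\: N| = #|(A :|: B) :\: N|.
  rewrite setDUl cardsU (_ : _ :&: _ = set0) ?cards0 ?subn0 //.
  apply/setP => x; rewrite !inE; have := disjointFr dAB (x := x).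
  by case: (x \in A) => [->|]; rewrite ?andbF.
by rewrite subset_leq_card // setSD // subUset AV.
Qed.

(** A weak form of the Andrasfai-Erdos-Sos theorem: a graph without cliques of size q + 1
    (where q = k.+1) in which every vertex has at most about n / q nonneighbors
    is q-partite.  Fix a clique Y of size q and let A v consist of the vertices
    adjacent to all of Y except v.  These q sets are independent, disjoint,
    and cover all but E vertices, so each has nearly n / q vertices.  A vertex
    without neighbors in A v has almost all its nonneighbors in A v, and is
    therefore adjacent to almost all of the other sets.  Any two adjacent
    vertices of this kind for the same v, and any vertex with neighbors in
    every A v, would extend greedily to a clique of size q + 1; so the color of a
    vertex can be a v for which it has no neighbor in A v. *)
Lemma dense_clique_free_colorable (T : finType) (e : rel T) (k E P : nat)
    (W : {set T}) :
  symmetric e -> irreflexive e -> clique_free e k.+2 W ->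
  {in W, forall x, #|W :\: nbrs e W x| <= P} ->
  k.+1 * P <= #|W| + E -> (2 * k.+1 + 1) ^ 2 * E < #|W| ->
  exists chi : T -> 'I_k.+1, {in W &, forall x y, e x y -> chi x != chi y}.
Proof.
move=> esym eirr freeW degW leP ltE.
have [Y [cY cardY YW]] : exists Y : {set T},
    [/\ clique e Y, #|Y| = k.+1 & Y \subset W].
  have [||||Y [cY cardY inY]] := @greedy_clique T 'I_k.+1 e (fun _ => W) P
    (enum 'I_k.+1) set0 esym eirr (enum_uniq _).
  - by move=> x y; rewrite inE.
  - by move=> i x _; rewrite inE.
  - by move=> i j x _ _ _ /degW.
  - by move=> i _; rewrite cards0 size_enum_ord /=; nia.
  exists Y; split; rewrite ?cardY ?cards0 ?size_enum_ord //.
  by apply/subsetP => y /inY[|[] //]; rewrite inE.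
have YmemW y : y \in Y -> y \in W by apply: (subsetP YW).
pose A v := [set x in W | [forall u in Y, (u != v) ==> e u x]].
have AW v : A v \subset W by apply/subsetP => x; rewrite inE => /andP[].
have Aadj v u x : x \in A v -> u \in Y -> u != v -> e x u.
  rewrite inE esym => /andP[_ /forallP/(_ u)].
  by move=> /implyP h uY uv; move: (h uY); rewrite uv.
have Aself v : v \in Y -> v \in A v.
  move=> vY; rewrite inE YmemW //=; apply/forall_inP => u uY; apply/implyP => uv.
  exact: cY.
(* Otherwise x |: Y would be a clique of size k.+2. *)
have notall x : x \in W -> exists2 v, v \in Y & ~~ e v x.
  move=> xW; apply/exists_inP; rewrite -negb_forall_in; apply/negP => /forall_inP all.
  have xY : x \notin Y by apply/negP => /all; rewrite eirr.
  apply: (freeW (x |: Y)); last by rewrite cardsU1 xY cardY.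
    by rewrite subUset sub1set xW.
  by apply: clique_extend => // y /all; rewrite esym.
have Adisj u v : u != v -> [disjoint A u & A v].
  move=> uv; rewrite disjoint_subset; apply/subsetP => x xu; apply/negP => xv.
  have [w wY] := notall x (subsetP (AW u) x xu).
  have [wu|wu] := eqVneq w u; rewrite esym.
    by rewrite (Aadj v) // wu.
  by rewrite (Aadj u).
have Aindep v x y : v \in Y -> x \in A v -> y \in A v -> ~~ e x y.
  move=> vY xA yA; apply/negP => exy.
  have cardYv : #|Y :\ v| = k by have := cardsD1 v Y; rewrite vY cardY add1n => -[].
  have notin z : z \in A v -> z \notin Y :\ v.
    by move=> zA; apply/negP; rewrite !inE => /andP[zv zY];
      have := Aadj v z z zA zY zv; rewrite eirr.
  have xNy : x \notin y |: (Y :\ v).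
    by rewrite in_setU1 negb_or notin // andbT; apply: contraTneq exy => ->;
      rewrite eirr.
  apply: (freeW (x |: (y |: (Y :\ v)))); last first.
  - by rewrite cardsU1 xNy cardsU1 notin // cardYv.
  - apply: clique_extend => //; first apply: clique_extend => //.
    + by move=> a b /setD1P[_ aY] /setD1P[_ bY]; apply: cY.
    + by move=> a /setD1P[av aY]; apply: (Aadj v).
    + by move=> a /setU1P[->//|/setD1P[av aY]]; apply: (Aadj v).
  - rewrite !subUset !sub1set (subsetP (AW v) x xA) (subsetP (AW v) y yA) /=.
    by apply: subset_trans YW; rewrite subD1set.
have Anone v x : v \in Y -> x \in A v -> nbrs e (A v) x = set0.
  move=> vY xA; apply/setP => y; rewrite !inE.
  by apply/negP => /andP[yA]; apply/negP; apply: Aindep vY xA _; rewrite inE.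
have nbrsS (V : {set T}) x : V \subset W -> V :\: nbrs e V x = V :\: nbrs e W x.
  move=> /subsetP VW; apply/setP => y; rewrite !inE.
  by case yV: (y \in V); rewrite ?andbF //= VW.
have Aupper v : v \in Y -> #|A v| <= P.
  move=> vY; apply: leq_trans (degW v (YmemW v vY)).
  apply: subset_leq_card; apply/subsetP => x xA.
  by rewrite !inE (negbTE (Aindep v v x vY (Aself v vY) xA)) andbF (subsetP (AW v)).
(* A vertex nonadjacent to exactly one v in Y lies in A v, and the vertices
   of Y have at most #|W| + E nonneighbors in total. *)
have cover : #|W| <= \sum_(v in Y) #|A v| + E.
  have : 2 * #|W| <= \sum_(v in Y) #|W :\: nbrs e W v| + \sum_(v in Y) #|A v|.
    have -> : \sum_(v in Y) #|W :\: nbrs e W v| = \sum_(x in W) #|nbrs (fun x v => ~~ e v x) Y x|.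
      rewrite (@double_count _ (fun x v => ~~ e v x)); last by move=> x y; rewrite esym.
      by apply: eq_bigr => v _; apply: eq_card => x; rewrite !inE esym;
        case: (x \in W); rewrite ?andbF ?andbT.
    have -> : \sum_(v in Y) #|A v| = \sum_(x in W) #|[set v in Y | x \in A v]|.
      transitivity (\sum_(v in Y) \sum_(x in W) (x \in A v)).
        apply: eq_bigr => v _;
          rewrite -[A v](setIidPr (AW v)) -sum1_card big_mkcond [RHS]big_mkcond /=.
        by apply: eq_bigr => x _; rewrite inE; case: (x \in W) => //=;
          case: (x \in A v).
      rewrite exchange_big; apply: eq_bigr => x _ /=.
      rewrite -sum1dep_card big_mkcondr; apply: eq_bigr => v _.
      by case: (x \in A v).
    rewrite -big_split /= mulnC -sum_nat_const; apply: leq_sum => x xW.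
    have [v vY nev] := notall x xW.
    have vN : v \in nbrs (fun x v => ~~ e v x) Y x by rewrite inE vY.
    have [/eqP/cards1P[u Nu]|N1] := eqVneq #|nbrs (fun x v => ~~ e v x) Y x| 1.
      rewrite Nu cards1 add1n ltnS; apply/card_gt0P; exists v.
      rewrite !inE vY xW /=; apply/forall_inP => w wY; apply/implyP => wv.
      apply: contraT => new.
      have wN : w \in nbrs (fun x v => ~~ e v x) Y x by rewrite inE wY.
      by move: wN vN wv; rewrite Nu !inE => /eqP -> /eqP ->; rewrite eqxx.
    apply: leq_trans (leq_addr _ _).
    rewrite ltn_neqAle eq_sym N1; apply/card_gt0P; by exists v.
  have : \sum_(v in Y) #|W :\: nbrs e W v| <= k.+1 * P.
    by rewrite -cardY -sum_nat_const; apply: leq_sum => v /YmemW/degW.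
  lia.
have Alower v : v \in Y -> P <= #|A v| + 2 * E.
  move=> vY; move: cover; rewrite (big_setD1 v) //=.
  have : \sum_(u in Y :\ v) #|A u| <= k * P.
    have <- : #|Y :\ v| = k by have := cardsD1 v Y; rewrite vY cardY add1n => -[].
    by rewrite -sum_nat_const; apply: leq_sum => u /setD1P[_ /Aupper].
  lia.
have Plarge : 4 * k.+1 * E + 4 * E < P.
  have : \sum_(v in Y) #|A v| <= k.+1 * P.
    by rewrite -cardY -sum_nat_const; apply: leq_sum => v /Aupper.
  move=> h; rewrite -(ltn_pmul2l (ltn0Sn k)).
  have -> : k.+1 * (4 * k.+1 * E + 4 * E) = (2 * k.+1 + 1) ^ 2 * E - E.
    have -> : (2 * k.+1 + 1) ^ 2 * E = k.+1 * (4 * k.+1 * E + 4 * E) + E by ring.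
    by rewrite addnK.
  lia.
(* All of A v is already nonadjacent to x, and #|A v| is almost P. *)
have few v u x : v \in Y -> u \in Y -> u != v -> x \in W ->
    nbrs e (A v) x = set0 -> #|A u :\: nbrs e W x| <= 2 * E.
  move=> vY uY uv xW none.
  have := card_setDU (nbrs e W x) (AW u) (AW v) (Adisj u v uv).
  have -> : A v :\: nbrs e W x = A v by rewrite -nbrsS // none setD0.
  have := degW x xW; have := Alower v vY; lia.
have nolarge v x y (U : T -> {set T}) : v \in Y -> x \in W -> y \in W -> e x y ->
    (forall u, u \in Y -> u != v -> [/\ U u \subset A u, 2 * k.+1 * E < #|U u|,
      #|U u :\: nbrs e W x| <= 2 * E & #|U u :\: nbrs e W y| <= 2 * E]) -> False.
  move=> vY xW yW exy HU.
  have size_ks : size (enum (Y :\ v)) = k.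
    by rewrite -cardE; have := cardsD1 v Y; rewrite vY cardY add1n => -[].
  have cardxy : #|[set x; y]| = 2.
    by rewrite cards2; case: eqVneq exy => // ->; rewrite eirr.
  have UW u : u \in Y -> u != v -> U u \subset W.
    by move=> uY uv; have [UA _ _ _] := HU u uY uv; apply: subset_trans UA (AW u).
  have [|||| S [cS cardS inS]] := @greedy_clique T T e U (2 * E)
    (enum (Y :\ v)) [set x; y] esym eirr (enum_uniq _).
  - apply: clique_extend => // [a b|a]; rewrite !inE; last by move/eqP ->.
    by move=> /eqP -> /eqP ->; rewrite eqxx.
  - move=> u a; rewrite mem_enum => /setD1P[uv uY].
    have [_ _ hx hy] := HU u uY uv.
    by rewrite nbrsS ?UW // !inE => /orP[] /eqP ->.
  - move=> u t a; rewrite !mem_enum => /setD1P[uv uY] /setD1P[tv tY] ut aU.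
    have [UA _ _ _] := HU u uY uv; have aA := subsetP UA a aU.
    have [UA' _ _ _] := HU t tY tv.
    rewrite nbrsS ?UW //; apply: leq_trans (_ : #|A t :\: nbrs e W a| <= _).
      by rewrite subset_leq_card // setSD.
    by apply: (few u) => //; [rewrite eq_sym|exact: subsetP (AW u) a aA|exact: Anone].
  - move=> u; rewrite mem_enum => /setD1P[uv uY].
    have [_ lt _ _] := HU u uY uv; rewrite cardxy size_ks; lia.
  apply: (freeW S) => //; last by rewrite cardS cardxy size_ks.
  apply/subsetP => a /inS[|[u]]; first by rewrite !inE => /orP[] /eqP ->.
  by rewrite mem_enum => /setD1P[uv uY] aU; apply: subsetP (UW u uY uv) a aU.
have classed x : x \in W -> exists2 v, v \in Y & nbrs e (A v) x == set0.
  move=> xW; apply/exists_inP; apply: contraT;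
    rewrite negb_exists_in => /forall_inP some.
  have [v0 v0Y _] := notall x xW.
  (* If x has fewest neighbors in A v, it has at least about half of every
     other A u, because its nonneighbors number at most P. *)
  case: (arg_minnP (fun v => #|nbrs e (A v) x|) v0Y) => v /= vY vmin.
  have {}vY : v \in Y by [].
  have /set0Pn[a] := some v vY; rewrite inE => /andP[aA exa].
  have aW := subsetP (AW v) a aA.
  exfalso; apply: (@nolarge v x a (fun u => nbrs e (A u) x)) => // u uY uv.
  have UA : nbrs e (A u) x \subset A u by apply/subsetP => y; rewrite inE => /andP[].
  split=> //.
  - have := card_setDU (nbrs e W x) (AW u) (AW v) (Adisj u v uv).
    have split w : #|A w| = #|nbrs e (A w) x| + #|A w :\: nbrs e W x|.
      rewrite -nbrsS // -(cardsID (nbrs e (A w) x) (A w)) (setIidPr _) //.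
      by apply/subsetP => y; rewrite inE => /andP[].
    have := split u; have := split v; have := Alower v vY; have := Alower u uY.
    have := vmin u uY; have := degW x xW; lia.
  - rewrite (_ : _ :\: _ = set0) ?cards0 //; apply/setP => y; rewrite !inE.
    by case: (y \in W); case: (e x y); rewrite ?andbF //= ?andbF //; case: (y \in A u).
  - apply: leq_trans (_ : #|A u :\: nbrs e W a| <= _);
    first by rewrite subset_leq_card // setSD.
    by apply: (few v) => //; apply: Anone.
have indep v x y : v \in Y -> x \in W -> y \in W -> nbrs e (A v) x == set0 ->
    nbrs e (A v) y == set0 -> ~~ e x y.
  move=> vY xW yW /eqP nx /eqP ny; apply/negP => exy.
  apply: (@nolarge v x y A) => // u uY uv; split=> //; try exact: (few v).
  have := Alower u uY; lia.
pose sel x := odflt x [pick v in Y | nbrs e (A v) x == set0].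
have selP x : x \in W -> sel x \in Y /\ nbrs e (A (sel x)) x == set0.
  move=> /classed[v vY hv]; rewrite /sel; case: pickP => [u /andP[]//|/(_ v)].
  by rewrite vY hv.
exists (fun x => inord (index (sel x) (enum Y))) => x y xW yW exy.
have [sxY hx] := selP x xW; have [syY hy] := selP y yW.
apply: contraTneq exy => eqc; apply: (indep (sel x)) => //.
suff -> : sel x = sel y by [].
have lt v : v \in Y -> index v (enum Y) < k.+1.
  by move=> vY; rewrite -cardY cardE index_mem mem_enum.
have := congr1 val eqc; rewrite /= !inordK ?lt // => eqi.
by rewrite -(nth_index x (s := enum Y) (x := sel x)) ?mem_enum // eqi nth_index ?mem_enum.
Qed.

Lemma degree_sumD1 (T : finType) (e : rel T) (W : {set T}) (v : T) :
  symmetric e -> irreflexive e -> v \in W ->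
  degree_sum e W = degree_sum e (W :\ v) + 2 * #|nbrs e W v|.
Proof.
move=> esym eirr vW; rewrite /degree_sum (big_setD1 v) //=.
have D1v : W :\: (W :\ v) = [set v].
  by apply/setP => x; rewrite !inE negb_and negbK; case: eqVneq => [->|_] /=;
    last exact: andNb.
rewrite (eq_bigr (fun x => #|nbrs e (W :\ v) x| + #|nbrs e [set v] x|)); last first.
  by move=> x _; rewrite (card_nbrsD _ _ (subD1set W v)) D1v.
rewrite big_split /= (double_count _ [set v]) // big_set1.
have -> : nbrs e (W :\ v) v = nbrs e W v.
  by apply/setP => x; rewrite !inE; case: eqVneq => // ->; rewrite eirr !andbF.
lia.
Qed.

(** Large enough for a slack N / K in the degrees, for at least N / 2 vertices,
    to meet the threshold (2 k.+1 + 1)^2 of [dense_clique_free_colorable]. *)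
Definition stability_constant (k : nat) : nat := 3 * (2 * k.+1 + 1) ^ 2.

(** The set W minimizes the Turan deficiency of W minus a multiple of its size.
    Minimality gives large degrees inside W, since otherwise deleting a vertex
    would decrease the functional; comparison with the whole vertex set bounds
    the number of deleted vertices, since the deficiency of W is nonnegative by
    Turan's theorem. *)
Lemma turan_stability (T : finType) (e : rel T) (k : nat) :
  symmetric e -> irreflexive e -> clique_free e k.+2 [set: T] ->
  stability_constant k * k.+2 <= #|T| ->
  exists (W : {set T}) (chi : T -> 'I_k.+1),
    {in W &, forall x y, e x y -> chi x != chi y} /\
    #|T| * #|~: W| + 2 * stability_constant k * (k.+1 * degree_sum e [set: T])
      <= 2 * stability_constant k * (k * #|T| ^ 2).
Proof.
move=> esym eirr free; set N := #|T|; set K := stability_constant k => largeN.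
pose Phi (W : {set T}) : int :=
  (K%:Z * (k%:Z * #|W|%:Z ^+ 2 - k.+1%:Z * (degree_sum e W)%:Z) - N%:Z * #|W|%:Z)%R.
have freeS (W : {set T}) : clique_free e k.+2 W.
  by move=> S _; apply: free; rewrite subsetT.
have turanS W := turan esym eirr (freeS W).
case: (@arg_minP _ _ _ [set: T] xpredT Phi isT) => W _ Wmin.
have cardW : #|W| + #|~: W| = N by rewrite cardsC.
have small : N * #|~: W| + K * (k.+1 * degree_sum e [set: T]) <= K * (k * N ^ 2).
  have := Wmin [set: T] isT; have := turanS W.
  rewrite /Phi cardsT -/N; move: cardW (degree_sum e W) (degree_sum e [set: T]).
  move: #|W| #|~: W| => a b <- D D' hD.
  nia.
(* If W is small then most vertices are deleted; delete them all. *)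
have [smallW|largeW] := ltnP (2 * #|W|) N.
  exists set0, (fun _ => ord0); split=> [x y|]; first by rewrite inE.
  rewrite setC0 cardsT -/N.
  have : N * N <= 2 * (N * #|~: W|) by rewrite mulnCA leq_mul2l; lia.
  lia.
(* Minimality of W against W :\ x. *)
have deg x : x \in W -> 2 * K * (k.+1 * #|W :\: nbrs e W x|) <= 2 * K * #|W| + K * k + N.
  move=> xW; have := Wmin (W :\ x) isT; rewrite /Phi.
  rewrite (degree_sumD1 esym eirr xW).
  have cW : #|W| = #|W :\ x|.+1 by rewrite (cardsD1 x) xW.
  have : #|W :\: nbrs e W x| + #|nbrs e W x| = #|W|.
    rewrite addnC -(cardsID (nbrs e W x) W) (setIidPr _) //.
    by apply/subsetP => y; rewrite inE => /andP[].
  rewrite cW; move: #|W :\ x| #|W :\: _| #|nbrs e W x| (degree_sum e _) => a b c D.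
  nia.
have K0 : 0 < K by [].
pose E := N %/ K; pose P := (#|W| + E) %/ k.+1.
have NE : N < K * E + K by rewrite mulnC /E {1}(divn_eq N K) ltn_add2l ltn_mod.
have EN : K * E <= N by rewrite mulnC leq_divM.
have [|||chi chiP] := @dense_clique_free_colorable T e k E P W esym eirr (freeS W).
- move=> x /deg h; rewrite /P leq_divRL // mulnC.
  rewrite -(leq_pmul2l (_ : 0 < 2 * K)) ?muln_gt0 //; nia.
- by rewrite mulnC leq_divM.
- have : 3 * ((2 * k.+1 + 1) ^ 2 * E) <= N by rewrite mulnA.
  have : 0 < N by apply: leq_trans largeN; rewrite muln_gt0.
  lia.
exists W, chi; split=> //.
by rewrite -!(mulnA 2); lia.
Qed.

(** * Set-colorings and codes *)

Local Open Scope ring_scope.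

Lemma subset_of_card (T : finType) (A : {set T}) (s : nat) :
  (s <= #|A|)%N -> exists2 B : {set T}, B \subset A & #|B| = s.
Proof.
move=> sA; exists [set x in take s (enum A)].
  by apply/subsetP => x; rewrite inE => /mem_take; rewrite mem_enum.
rewrite cardsE; have /card_uniqP -> := take_uniq s (enum_uniq A).
by rewrite size_take -cardE; case: ltngtP sA.
Qed.

(** If a code had at least as many words as the Ramsey number, coloring the edges by
    coordinates where the words differ would produce a clique of q + 1 words
    with pairwise distinct letters in one coordinate. *)
Lemma max_code_lt_set_ramsey (q r s : nat) : (0 < s < r)%N ->
  (max_code q r s < set_ramsey (q + 1) r s)%N.
Proof.
move=> /(set_ramseyP (q + 1)) [arrow _]; set N := set_ramsey _ _ _ in arrow *.
rewrite ltnNge; apply/negP => leN.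
have [C dC cardC] : exists2 C : {set {ffun 'I_r -> 'I_q}}, min_dist_geq s C & (N <= #|C|)%N.
  have C0 : min_dist_geq s (set0 : {set {ffun 'I_r -> 'I_q}}).
    by apply/forall_inP => x; rewrite inE.
  have C0' : (0 < #|[pred C : {set {ffun 'I_r -> 'I_q}} | min_dist_geq s C]|)%N.
    by apply/card_gt0P; exists set0.
  have [C dC maxE] := eq_bigmax_cond (fun C : {set _} => #|C|) C0'.
  by exists C => //; rewrite -maxE.
pose f (x : 'I_N) : {ffun 'I_r -> 'I_q} := enum_val (widen_ord cardC x).
have f_far x y : x != y -> (s <= hamming (f x) (f y))%N.
  move=> xy; have fxy : f x != f y.
    by apply: contraNneq xy => /enum_val_inj/(congr1 val)/= eq; apply/eqP/val_inj.
  have /forall_inP/(_ _ (enum_valP (widen_ord cardC x)))/forall_inP := dC.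
  by move=> /(_ _ (enum_valP (widen_ord cardC y)))/implyP; apply.
pose ok (e : {set 'I_N}) (B : {set 'I_r}) := (#|B| == s) &&
  [forall x in e, forall y in e, (x != y) ==> (B \subset [set i | f x i != f y i])].
pose c e := odflt set0 [pick B | ok e B].
have cP (e : {set 'I_N}) : #|e| = 2 -> ok e (c e).
  move=> /eqP/cards2P[x [y [xy ->]]]; rewrite /c; case: pickP => [//|none].
  have [B BD cardB] := subset_of_card (f_far x y xy).
  have DC a b : [set i | f a i != f b i] = [set i | f b i != f a i].
    by apply/setP => i; rewrite !inE eq_sym.
  suff okB : ok [set x; y] B by rewrite none in okB.
  rewrite /ok cardB eqxx /=; apply/forall_inP => a; rewrite !inE => ha.
  apply/forall_inP => b; rewrite !inE => hb; apply/implyP.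
  by case/orP: ha hb => /eqP -> /orP[] /eqP ->; rewrite ?eqxx // DC.
have cs : set_coloring s c by move=> e /cP/andP[/eqP].
have [S [cardS [a aS]]] := arrow c cs.
have inj : {in S &, injective (fun x => f x a)}.
  move=> x y xS yS /eqP; apply: contraTeq => xy.
  have card_e : #|[set x; y]| = 2 by rewrite cards2 xy.
  have sub : [set x; y] \subset S by apply/subsetP => z; rewrite !inE => /orP[] /eqP ->.
  have /andP[_ /forall_inP/(_ x)] := cP _ card_e; rewrite set21 => /(_ isT).
  move=> /forall_inP/(_ y); rewrite set22 => /(_ isT); rewrite xy => /subsetP/(_ a).
  by rewrite inE => /(_ (aS _ sub card_e)).
have := max_card [set f x a | x in S].
by rewrite card_in_imset // cardS card_ord addn1 ltnn.
Qed.

(** The vertices kept are those deleted by [turan_stability] for at most 2 L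
    colors.  If x and y are deleted for none of the colors of the edge xy, their
    classes differ in all of them; in general at most 4 L colors are lost.  The
    inequality with L says that the color classes are, in total, within L N^2
    of the Turan bound, up to the scaling of [turan_stability]. *)
Lemma coloring_code (k r s N L : nat) (c : {set 'I_N} -> {set 'I_r}) :
  set_coloring s c -> (forall S, ~ common_color_clique k.+2 c S) ->
  (stability_constant k * k.+2 <= N)%N ->
  (2 * stability_constant k * (r * (k * N ^ 2))
     <= 2 * stability_constant k * (k.+1 * (s * (N * (N - 1)))) + L * N ^ 2)%N ->
  exists (T : finType) (w : T -> 'I_r -> 'I_k.+1), (N <= 2 * #|T|)%N /\
    forall x y, x != y -> (s <= #|[set i | w x i != w y i]| + 4 * L)%N.
Proof.
move=> cs noclique largeN hL; set K := stability_constant k in largeN hL.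
pose e i (x y : 'I_N) := (x != y) && (i \in c [set x; y]).
have esym i : symmetric (e i).
  move=> x y; rewrite /e eq_sym (_ : [set x; y] = [set y; x]) //.
  by apply/setP => z; rewrite !inE orbC.
have eirr i : irreflexive (e i) by move=> x; rewrite /e eqxx.
have efree i : clique_free (e i) k.+2 [set: 'I_N].
  move=> S _ cS cardS; apply: (noclique S); split=> //; exists i => f fS /eqP/cards2P.
  move=> [x [y [xy fE]]]; move: fS; rewrite fE subUset !sub1set => /andP[xS yS].
  by have /andP[] := cS x y xS yS xy.
have stab i := turan_stability (esym i) (eirr i) (efree i).
rewrite card_ord -/K in stab.
have [W /fin_all_exists[chi HW]] := fin_all_exists (fun i => stab i largeN).
(* The number of colors for which x is deleted. *)
pose b x := (\sum_i (x \notin W i))%N.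
have sumb : (\sum_x b x <= L * N)%N.
  have -> : (\sum_x b x = \sum_i #|~: W i|)%N.
    rewrite exchange_big; apply: eq_bigr => i _ /=.
    rewrite -sum1_card [RHS]big_mkcond; apply: eq_bigr => x _.
    by rewrite inE; case: (x \in W i).
  have sumD : (\sum_i degree_sum (e i) [set: 'I_N] = s * (N * (N - 1)))%N.
    rewrite exchange_big /= (eq_bigr (fun _ => s * (N - 1))%N); last first.
      move=> x _; transitivity (\sum_(y | y != x) \sum_i (i \in c [set x; y] : nat))%N.
        rewrite exchange_big; apply: eq_bigr => i _ /=.
        rewrite -sum1dep_card big_mkcond [RHS]big_mkcond; apply: eq_bigr => y _.
        rewrite inE /e eq_sym; case: (y == x) => //=; by case: (i \in _).
      transitivity (\sum_(y | y != x) s)%N.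
        apply: eq_bigr => y yx; rewrite -(cs [set x; y]) ?cards2 1?eq_sym ?yx //.
        by rewrite -sum1_card [RHS]big_mkcond; apply: eq_bigr => i _; case: (i \in _).
      rewrite sum_nat_const mulnC; congr (_ * _)%N.
      by have := cardC1 x; rewrite card_ord -subn1 => <-; apply: eq_card => y;
        rewrite !inE.
    rewrite sum_nat_const; have -> : #|[set: 'I_N]| = N by rewrite cardsT card_ord.
    ring.
  have : (\sum_i (N * #|~: W i| + 2 * K * (k.+1 * degree_sum (e i) [set: 'I_N]))
      <= \sum_(i < r) 2 * K * (k * N ^ 2))%N.
    by apply: leq_sum => i _; have [_] := HW i.
  rewrite big_split /= -!big_distrr /= sumD sum_nat_const card_ord.
  have N0 : (0 < N)%N by apply: leq_trans largeN; rewrite muln_gt0.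
  move=> h; rewrite -(leq_pmul2l N0).
  have -> : (N * (L * N) = L * N ^ 2)%N by ring.
  rewrite -(leq_add2r (2 * K * (k.+1 * (s * (N * (N - 1)))))).
  apply: leq_trans h _; rewrite addnC in hL; apply: leq_trans hL; apply/eq_leq; ring.
pose G := [set x | (b x <= 2 * L)%N].
have cardG : (N <= 2 * #|G|)%N.
  have := cardsC G; rewrite card_ord => cardN.
  have : ((2 * L).+1 * #|~: G| <= L * N)%N.
    apply: leq_trans sumb;
      rewrite mulnC -sum_nat_const [X in (_ <= X)%N](bigID (mem (~: G))) /=.
    apply: leq_trans (leq_addr _ _); apply: leq_sum => x.
    by rewrite !inE -ltnNge.
  have : (2 * #|~: G| <= N)%N -> (N <= 2 * #|G|)%N by lia.
  move=> h h'; apply: h; have [L0|L0] := posnP L; first by move: h'; rewrite L0; lia.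
  by rewrite -(leq_pmul2l L0); lia.
exists {x | x \in G}, (fun x i => chi i (val x)); split.
  by rewrite card_sig; apply: leq_trans cardG _; rewrite leq_mul2l; apply/orP; right;
    apply/eq_leq/eq_card.
move=> x y xy; set D := [set i | _].
pose B (z : 'I_N) := [set i | z \notin W i].
have cardB z : z \in G -> (#|B z| <= 2 * L)%N.
  rewrite inE; apply: leq_trans; rewrite -sum1dep_card big_mkcond.
  by apply: eq_leq; apply: eq_bigr => i _; case: (z \notin _).
have xy' : val x != val y by rewrite (inj_eq val_inj).
have : (s <= #|D :|: (B (val x) :|: B (val y))|)%N.
  rewrite -(cs [set val x; val y]) ?cards2 ?xy' //;
    apply/subset_leq_card/subsetP => i ic.
  rewrite !inE; have [xW|//] := boolP (val x \in W i); last by rewrite orbT.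
  have [yW|//] := boolP (val y \in W i); last by rewrite !orbT.
  have [proper _] := HW i; rewrite proper // /e xy' ic //.
move=> /leq_trans; apply; apply: leq_trans (leq_card_setU _ _) _; rewrite leq_add2l.
apply: leq_trans (leq_card_setU _ _) _.
rewrite (_ : 4 * L = 2 * L + 2 * L)%N; last by lia.
by apply: leq_add; apply: cardB; apply: valP.
Qed.

Lemma max_codeP (q r d : nat) :
  exists2 C : {set {ffun 'I_r -> 'I_q}}, min_dist_geq d C & #|C| = max_code q r d.
Proof.
have C0 : (0 < #|[pred C : {set {ffun 'I_r -> 'I_q}} | min_dist_geq d C]|)%N.
  apply/card_gt0P; exists set0; rewrite inE.
  by apply/forall_inP => x; rewrite inE.
by have [C dC maxE] := eq_bigmax_cond (fun C : {set _} => #|C|) C0; exists C.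
Qed.

Lemma par_mean (q m : nat) : prime_power q -> (0 < m)%N ->
  let q' : rat := q%:R in let Q : rat := (q ^ m)%:R in
  [/\ 2 <= q', q' <= Q, (1 - q'^-1) * (par_r q m)%:R = (Q ^+ 2 + 1) * (Q - 1) / q' &
      (par_s q m)%:R = Q ^+ 2 * (Q - 1) / q'].
Proof.
move=> hq m0 q' Q; have q1 := prime_power_gt1 hq.
have leqQ : (q <= q ^ m)%N by apply: leq_trans (leq_pexp2l (ltnW q1) m0).
have q2 : 2 <= q' by rewrite ler_nat.
have Q0 : (0 < q ^ m)%N := leq_trans (ltnW q1) leqQ.
have rE : (par_r q m)%:R * (q' - 1) = (Q ^+ 2 + 1) * (Q - 1).
  have := congr1 (fun n => n%:R : rat) (par_r_nat m q1).
  by rewrite !natrM !natrB ?(ltnW q1) // natrD natrX.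
have sE : (par_s q m)%:R * q' = Q ^+ 2 * (Q - 1).
  have := congr1 (fun n => n%:R : rat) (par_s_nat q m0).
  by rewrite !natrM natrB // natrX.
split=> //; first by rewrite ler_nat.
- rewrite -rE; field; lra.
- by rewrite -sE mulfK //; lra.
Qed.

(** The cubic bound with a = (1 - 1/q) r - s = (Q - 1) / q and b = sigma^2 / a. *)
Lemma max_code_le (q m : nat) : prime_power q -> (0 < m)%N ->
  (max_code q (par_r q m) (par_s q m) * ((q ^ m) ^ 2 - q ^ m + 2)
     <= (q ^ m) ^ 4 * ((q ^ m) ^ 2 + 1))%N.
Proof.
move=> hq m0; have q1 := prime_power_gt1 hq.
have [C dC <-] := max_codeP q (par_r q m) (par_s q m).
have [->|C0] := posnP #|C|; first by rewrite mul0n.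
have [q2 qQ muE sE] := par_mean hq m0.
set q' : rat := q%:R in q2 qQ muE sE; set Q : rat := (q ^ m)%:R in qQ muE sE.
pose a := (Q - 1) / q'; pose b := (Q ^+ 2 + 1) / q'.
have ge0_div (x : rat) : 0 <= x -> 0 <= x / q' by move=> x0; rewrite divr_ge0 //; lra.
have a0 : 0 <= a by apply: ge0_div; lra.
have ab : 2 * a <= b.
  rewrite -subr_ge0 (_ : b - 2 * a = (Q ^+ 2 + 1 - 2 * (Q - 1)) / q');
    last by rewrite /a /b; ring.
  apply: ge0_div; have := sqr_ge0 (Q - 1); nra.
have cardI : #|'I_q|%:R = q' :> rat by rewrite card_ord.
have := @code_size_bound rat {x | x \in C} 'I_(par_r q m) 'I_q (fun x => val x)
  ((Q ^+ 2 + 1) * (Q - 1) / q') a b.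
have cardT : #|{: {x | x \in C}}| = #|C| by rewrite card_sig; apply: eq_card.
rewrite !card_ord cardT -/q' muE => /(_ q1 C0 erefl a0 ab).
have far (x y : {x | x \in C}) : x != y ->
    (Q ^+ 2 + 1) * (Q - 1) / q' - a <= #|[set i | val x i != val y i]|%:R.
  move=> xy; rewrite (_ : _ - a = (par_s q m)%:R); last by rewrite sE /a; ring.
  rewrite ler_nat; have /forall_inP/(_ _ (valP x))/forall_inP/(_ _ (valP y)) := dC.
  by rewrite (inj_eq val_inj) xy.
move=> /(_ far).
have -> : (2 * b - a) * ((Q ^+ 2 + 1) * (Q - 1) / q' / q') - a * b ^+ 2 =
    (Q ^+ 2 - Q + 2) * ((Q ^+ 2 + 1) * (Q - 1) / q' ^+ 3) by rewrite /a /b; field; lra.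
have -> : ((Q ^+ 2 + 1) * (Q - 1) / q' - a) * ((Q ^+ 2 + 1) * (Q - 1) / q' + b) ^+ 2 =
    Q ^+ 4 * (Q ^+ 2 + 1) * ((Q ^+ 2 + 1) * (Q - 1) / q' ^+ 3) by rewrite /a /b;
      field; lra.
have pos : 0 < (Q ^+ 2 + 1) * (Q - 1) / q' ^+ 3.
  have := sqr_ge0 Q => sq0.
  by apply: divr_gt0; [apply: mulr_gt0; lra | apply: exprn_gt0; lra].
rewrite [X in X <= _]mulrA ler_pM2r // -(ler_nat rat) !natrM !natrD natrB ?(natrX _ (q ^ m)%N) -/Q //.
by rewrite -mulnn leq_pmull // expn_gt0 ltnW.
Qed.

(** Distances only within O(Q) of s still force O(Q^4) words: with a = kappa Q and
    b = sigma^2 / a, of order Q^2, the cubic bound divides at most 4 mu^3 by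
    at least sigma^2 b / 2, and mu is of order Q^3. *)
Lemma loose_code_size (q m kappa : nat) (T : finType)
    (w : T -> 'I_(par_r q m) -> 'I_q) :
  prime_power q -> (0 < m)%N -> (0 < kappa)%N ->
  (2 * q ^ 2 * kappa ^ 2 < q ^ m)%N ->
  (forall x y, x != y ->
     par_s q m + q ^ m <= #|[set i | w x i != w y i]| + kappa * q ^ m)%N ->
  (#|T| <= 8 * kappa * q * (q ^ m) ^ 4)%N.
Proof.
move=> hq m0 k0 largeQ far; have q1 := prime_power_gt1 hq.
have [->//|T0] := posnP #|T|.
have [q2 qQ muE sE] := par_mean hq m0.
set q' : rat := q%:R in q2 qQ muE sE; set Q : rat := (q ^ m)%:R in qQ muE sE.
pose mu := (Q ^+ 2 + 1) * (Q - 1) / q'; pose kap : rat := kappa%:R.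
have k1 : 1 <= kap by rewrite ler1n.
have large : 2 * q' ^+ 2 * kap ^+ 2 <= Q - 1.
  move: largeQ; rewrite -addn1 -(ler_nat rat) natrD !natrM.
  by rewrite -/Q -/q' -/kap -!expr2 lerBrDr.
have q0 : q' != 0 by lra.
have sq0 : 0 <= Q ^+ 2 by apply: sqr_ge0.
pose a := kap * Q; pose b := mu / (q' * a).
have a1 : Q <= a by rewrite /a; nra.
have a_neq0 : a != 0 by lra.
have mu_gt0 : 0 < mu by rewrite /mu divr_gt0 ?mulr_gt0 //; lra.
have qa1 : 1 <= q' * a by nra.
have muq : mu * q' = (Q ^+ 2 + 1) * (Q - 1) by rewrite /mu divfK.
have abE : q' * a * b = mu by rewrite /b mulrC divfK // mulf_neq0.
have ab : 2 * a <= b.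
  rewrite /b ler_pdivlMr; last by lra.
  rewrite -(ler_pM2r (_ : 0 < q')) ?muq; last by lra.
  have -> : 2 * a * (q' * a) * q' = (2 * q' ^+ 2 * kap ^+ 2) * Q ^+ 2 by rewrite /a;
    ring.
  apply: (@le_trans _ _ ((Q - 1) * Q ^+ 2)); first by rewrite ler_wpM2r.
  rewrite mulrC ler_wpM2r //; lra.
have b_le_mu : b <= mu.
  rewrite /b ler_pdivrMr; last by lra.
  by rewrite ler_peMr // ltW.
have a_le_mu : a <= mu by lra.
have := @code_size_bound rat T 'I_(par_r q m) 'I_q w mu a b.
rewrite !card_ord -/q' muE => /(_ q1 T0 erefl (ltW _) ab).
have a0 : 0 < a by lra.
move=> /(_ a0).
have far' x y : x != y -> mu - a <= #|[set i | w x i != w y i]|%:R.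
  move=> /far; rewrite -(ler_nat rat) !natrD natrM sE -/Q -/kap -/a.
  have : mu = Q ^+ 2 * (Q - 1) / q' + (Q - 1) / q' by rewrite /mu; ring.
  have : (Q - 1) / q' <= Q by rewrite ler_pdivrMr; nra.
  lra.
move=> /(_ far').
have -> : (2 * b - a) * (mu / q') - a * b ^+ 2 = a * b * (b - a).
  by rewrite -abE; field.
move=> bound.
have b0 : 0 < b by lra.
have up : #|T|%:R * (a * b * (b / 2)) <= mu * (mu + mu) ^+ 2.
  apply: (@le_trans _ _ (#|T|%:R * (a * b * (b - a)))).
    apply: ler_wpM2l => //; apply: ler_wpM2l; last by lra.
    by apply: mulr_ge0; apply: ltW.
  apply: le_trans bound _.
  apply: ler_pM; [lra|exact: sqr_ge0|lra|].
  by rewrite ler_sqr ?nnegrE; lra.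
have : #|T|%:R <= 8 * q' ^+ 2 * a * mu.
  have pos : 0 < a * b * (b / 2) by apply: mulr_gt0; [exact: mulr_gt0 | lra].
  rewrite -(ler_pM2r pos); apply: le_trans up _.
  by rewrite le_eqVlt -abE; apply/orP; left; apply/eqP; field.
have -> : 8 * q' ^+ 2 * a * mu = 8 * kap * q' * Q * ((Q ^+ 2 + 1) * (Q - 1)).
  by rewrite -muq /a; ring.
move=> /le_trans => bd; rewrite -(ler_nat rat); apply: bd.
have -> : (8 * kappa * q * (q ^ m) ^ 4)%:R = 8 * kap * q' * Q ^+ 4.
  by rewrite 3!natrM (natrX _ (q ^ m)%N).
have -> : 8 * kap * q' * Q ^+ 4 = 8 * kap * q' * Q * Q ^+ 3 by ring.
rewrite ler_wpM2l ?mulr_ge0 //; try lra.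
have -> : (Q ^+ 2 + 1) * (Q - 1) = Q ^+ 3 - Q ^+ 2 + (Q - 1) by ring.
nra.
Qed.

(** For Q = Z + 1 one has (q - 1) r = (Q^2 + 1) Z and q s = Q^2 Z, with difference
    Z: the total deficiency of the color classes is at most Q N^2, in the scaling
    of [turan_stability], as soon as q s <= N. *)
Lemma turan_slack (K Z N : nat) : ((Z + 1) ^ 2 * Z <= N)%N ->
  (2 * K * (((Z + 1) ^ 2 + 1) * Z * N ^ 2)
    <= 2 * K * ((Z + 1) ^ 2 * Z * (N * (N - 1))) + 2 * K * (Z + 1) * N ^ 2)%N.
Proof.
case: N => [|N]; first by rewrite !muln0.
rewrite subn1 /= mulnDl mul1n -[(2 * K * (Z + 1) * _)%N]mulnA -mulnDr leq_mul2l.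
move: ((Z + 1) ^ 2 * Z)%N => X h; apply/orP; right.
have := leq_mul (leqnn N.+1) h; lia.
Qed.

Lemma par_s_between (q m : nat) : prime_power q -> (0 < m)%N -> (2 < q ^ m)%N ->
  (0 < par_s q m < par_r q m)%N.
Proof.
move=> hq m0 Q2; have q1 := prime_power_gt1 hq.
have rE := par_r_nat m q1; have sE := par_s_nat q m0.
have Q1 : (0 < q ^ m - 1)%N by rewrite subn_gt0 ltnW.
apply/andP; split.
  by rewrite -(ltn_pmul2r (ltnW q1)) sE mul0n muln_gt0 Q1 expn_gt0 expn_gt0 ltnW.
rewrite -(ltn_pmul2r (ltnW q1)) sE; apply: (@leq_trans (par_r q m * (q - 1)).+1).
  rewrite ltnS rE leq_mul2r; apply/orP; right; exact: leq_addr.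
have : (0 < par_r q m)%N by move: rE; case: (par_r q m) => //; rewrite mul0n; nia.
by rewrite mulnBr muln1 => r0; have := leq_pmulr (par_r q m) (ltnW q1); lia.
Qed.

(** A coloring of one vertex less than the Ramsey number yields a code with half as many
    words, at distance s - O(Q), once Q exceeds a constant depending on q; the
    sum in C takes care of the other values of m. *)
Lemma set_ramsey_le (q : nat) : prime_power q ->
  exists C : nat, forall m : nat, (0 < m)%N -> (2 < q ^ m)%N ->
    (set_ramsey (q + 1) (par_r q m) (par_s q m) <= C * (q ^ m) ^ 4)%N.
Proof.
move=> hq; have q1 := prime_power_gt1 hq.
pose R m := set_ramsey (q + 1) (par_r q m) (par_s q m).
(* With L = 2 K Q, words lose 4 L = 8 K Q coordinates, and s itself is less
   than Q below the mean distance. *)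
pose K := stability_constant q.-1; pose kappa := (8 * K + 1)%N.
pose C0 := (16 * kappa * q + K * (q + 1) + 2)%N.
pose Q0 := (2 * q ^ 2 * kappa ^ 2).+1.
exists (C0 + \sum_(m < Q0) R m)%N => m m0 Q2.
have Qpos : (0 < (q ^ m) ^ 4)%N by rewrite expn_gt0 ltnW // ltnW.
have [small|large] := ltnP (q ^ m) Q0.
  have mQ : (m < Q0)%N by apply: leq_ltn_trans small; apply/ltnW/ltn_expl.
  rewrite mulnDl; apply: leq_trans (leq_addl _ _); apply: leq_trans (leq_pmulr _ Qpos).
  by rewrite (bigD1 (Ordinal mQ)) //= leq_addr.
rewrite mulnDl; apply: leq_trans (leq_addr _ _).
have s_gt0_ltr := par_s_between hq m0 Q2.
have [_ minR] := set_ramseyP (q + 1) s_gt0_ltr.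
rewrite leqNgt; apply/negP => ltR; have R0 := leq_ltn_trans (leq0n _) ltR.
set R0' := set_ramsey _ _ _ in minR ltR R0; pose N := R0'.-1.
suff /minR : set_arrow (q + 1) (par_r q m) (par_s q m) N by rewrite leqNgt /N prednK ?leqnn.
have leN : (C0 * (q ^ m) ^ 4 <= N)%N by rewrite -ltnS /N prednK.
move=> c cs; apply: boolp.contrapT => none.
have kE : q.-1.+1 = q by rewrite prednK // ltnW.
have kE2 : (q + 1 = q.-1.+2)%N by rewrite kE addn1.
have noclique S : ~ common_color_clique q.-1.+2 c S.
  by move=> cS; apply: none; exists S; rewrite kE2.
have largeN : (K * q.-1.+2 <= N)%N.
  rewrite kE -addn1; apply: leq_trans leN; apply: leq_trans (leq_pmulr _ Qpos).
  by rewrite /C0; lia.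
have hL : (2 * K * (par_r q m * (q.-1 * N ^ 2))
  <= 2 * K * (q.-1.+1 * (par_s q m * (N * (N - 1)))) + 2 * K * q ^ m * N ^ 2)%N.
  have -> : (par_r q m * (q.-1 * N ^ 2) = ((q ^ m) ^ 2 + 1) * (q ^ m - 1) * N ^ 2)%N.
    by rewrite -par_r_nat // subn1 mulnA.
  have -> : (q.-1.+1 * (par_s q m * (N * (N - 1))) = (q ^ m) ^ 2 * (q ^ m - 1) * (N * (N - 1)))%N.
    by rewrite -par_s_nat // kE; ring.
  have : ((q ^ m) ^ 2 * (q ^ m - 1) <= N)%N.
    apply: leq_trans leN; apply: (@leq_trans ((q ^ m) ^ 4));
      last by rewrite leq_pmull // /C0; lia.
    by rewrite (expnD _ 2 2) leq_mul2l -mulnn; apply/orP; right; nia.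
  have [Z ->] : exists Z, (q ^ m = Z + 1)%N.
    by exists (q ^ m - 1)%N; rewrite subnK // ltnW // ltnW.
  by rewrite addnK; apply: turan_slack.
have [T [w [leT farw]]] := coloring_code cs noclique largeN hL.
move: w farw; rewrite kE => w farw.
have T_le : (#|T| <= 8 * kappa * q * (q ^ m) ^ 4)%N.
  apply: (@loose_code_size q m kappa T w) => // x y /farw; rewrite /kappa; nia.
have : (2 * #|T| < C0 * (q ^ m) ^ 4)%N.
  apply: (@leq_ltn_trans (16 * kappa * q * (q ^ m) ^ 4)).
    by move: T_le; move: ((q ^ m) ^ 4)%N => X; lia.
  by rewrite ltn_pmul2r // /C0; lia.
lia.
Qed.

(** * Asymptotics *)

Lemma cvg_powR1 (R : realType) (f : nat -> R) (p : R) :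
  (f @ \oo --> (1 : R))%classic -> ((fun m => f m `^ p) @ \oo --> (1 : R))%classic.
Proof.
move=> f1.
have : ((fun m => expR (p * ln (f m))) @ \oo --> (1 : R))%classic.
  rewrite -[X in (_ --> X)%classic]expR0 -(mulr0 p) -ln1.
  apply: continuous_cvg; first exact: continuous_expR.
  apply: cvgM; first exact: cvg_cst.
  by apply: continuous_cvg f1; apply: continuous_ln.
apply: cvg_trans; apply: near_eq_cvg.
near=> m; rewrite /powR gt_eqF //.
near: m; apply: (cvgr_gt (1 : R)) => //.
Unshelve. all: by end_near.
Qed.

Lemma cvg_invX (R : realType) (q : nat) : (1 < q)%N ->
  ((fun m => (q%:R ^+ m)^-1 : R) @ \oo --> (0 : R))%classic.
Proof.
move=> q1.
have -> : (fun m => (q%:R ^+ m)^-1 : R) = GRing.exp (q%:R^-1).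
  by apply/funext => m; rewrite exprVn.
apply: cvg_expr; rewrite ger0_norm ?invr_ge0 //.
by rewrite invf_lt1 ?ltr1n // ltr0n ltnW.
Qed.

Lemma cvg_ratio (R : realType) (u : nat -> R) (n d : {poly R}) :
  (u @ \oo --> (0 : R))%classic -> n.[0] = 1 -> d.[0] = 1 ->
  ((fun m => n.[u m] / d.[u m]) @ \oo --> (1 : R))%classic.
Proof.
move=> u0 n0 d0.
have poly_cvg (p : {poly R}) : ((fun m => p.[u m]) @ \oo --> p.[0])%classic.
  apply: (@continuous_cvg _ _ _ _ _ u (fun x => p.[x])) => //.
  exact: continuous_horner.
rewrite -[X in (_ --> X)%classic](divr1 1) -{1}n0 -d0.
by apply: cvgM => //; apply: cvgV => //; rewrite d0 oner_neq0.
Qed.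

(** Rational functions of Q are written in terms of 1 / Q, which tends to 0. *)
Lemma cvg_ratio_invX (R : realType) (q : nat) (f : nat -> R) (n d : {poly R}) :
  (1 < q)%N -> n.[0] = 1 -> d.[0] = 1 ->
  (forall m, (0 < m)%N -> f m = n.[(q%:R ^+ m)^-1] / d.[(q%:R ^+ m)^-1]) ->
  (f @ \oo --> (1 : R))%classic.
Proof.
move=> q1 n0 d0 fE; have := cvg_ratio (@cvg_invX R q q1) n0 d0.
apply: cvg_trans; apply: near_eq_cvg.
by near=> m; rewrite fE //; near: m; apply: nbhs_infty_gt.
Unshelve. all: by end_near.
Qed.

Lemma powRX (R : realType) (x p : R) (n : nat) :
  0 <= x -> (x ^+ n) `^ p = x `^ (n%:R * p).
Proof. by move=> x0; rewrite powRrM powR_mulrn. Qed.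

Lemma powR_cube (R : realType) (x : R) : 0 <= x -> (x ^+ 3) `^ (4 / 3) = x ^+ 4.
Proof. by move=> x0; rewrite powRX // -powR_mulrn //; congr powR; field. Qed.

Lemma par_real (R : realType) (q m : nat) : prime_power q -> (0 < m)%N ->
  let q' : R := q%:R in let Q := q' ^+ m in
  [/\ 1 < q', q' <= Q, (par_r q m)%:R = (Q ^+ 2 + 1) * (Q - 1) / (q' - 1),
      (par_j q m)%:R = (Q - 1) / (q' - 1) &
      (par_s q m)%:R = Q ^+ 2 * (Q - 1) / q'].
Proof.
move=> hq m0 q' Q; have q1 := prime_power_gt1 hq.
have leqQ : (q <= q ^ m)%N by apply: leq_trans (leq_pexp2l (ltnW q1) m0).
have q'1 : 1 < q' by rewrite ltr1n.
have Q0 : (0 < q ^ m)%N := leq_trans (ltnW q1) leqQ.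
have QE : (q ^ m)%:R = Q by rewrite natrX.
have cast (a b c : nat) : (a * b = c)%N -> a%:R * b%:R = c%:R :> R.
  by move=> <-; rewrite natrM.
have subq : (q - 1)%:R = q' - 1 by rewrite natrB // ltnW.
have subQ : (q ^ m - 1)%:R = Q - 1 by rewrite natrB // QE.
have X2 : ((q ^ m) ^ 2)%:R = Q ^+ 2 by rewrite (natrX _ (q ^ m)%N) QE.
have := cast _ _ _ (par_r_nat m q1); rewrite subq natrM natrD X2 subQ => rE.
have := cast _ _ _ (par_j_nat m q1); rewrite subq subQ => jE.
have := cast _ _ _ (par_s_nat q m0); rewrite natrM X2 subQ -/q' => sE.
split=> //; first by rewrite -QE ler_nat.
- by rewrite -rE mulfK //; lra.
- by rewrite -jE mulfK //; lra.
- by rewrite -sE mulfK //; lra.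
Qed.

(** The cube of the quotient is (Q - 1)^2 / (Q^2 + 1). *)
Lemma cvg_par_j (R : realType) (q : nat) : prime_power q ->
  ((fun m : nat => (par_j q m)%:R
     / ((q%:R - 1) `^ (- (2 / 3)) * (par_r q m)%:R `^ (1 / 3)) : R)
    @ \oo --> (1 : R))%classic.
Proof.
move=> hq; have q1 := prime_power_gt1 hq.
pose f m : R := (q%:R ^+ m - 1) ^+ 2 / ((q%:R ^+ m) ^+ 2 + 1).
have f1 : (f @ \oo --> (1 : R))%classic.
  apply: (@cvg_ratio_invX R q f ((1 - 'X) ^+ 2) (1 + 'X ^+ 2) q1); rewrite ?hornerE;
    try ring.
  move=> m m0; have [q'1 qQ _ _ _] := @par_real R q m hq m0; rewrite /f !hornerE.
  set Q := _ ^+ m in qQ *.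
  have : Q ^+ 2 + 1 != 0 by rewrite gt_eqF // ltr_wpDl ?sqr_ge0.
  by move=> h; field; rewrite ?h ?andbT; lra.
have := cvg_powR1 (1 / 3) f1; apply: cvg_trans; apply: near_eq_cvg.
near=> m; have m0 : (0 < m)%N by near: m; apply: nbhs_infty_gt.
have [q'1 qQ rE jE _] := @par_real R q m hq m0; rewrite /f rE jE.
set Q := _ ^+ m in qQ *; set y := q%:R - 1; have y0 : 0 < y by rewrite /y; lra.
have Q1 : 0 < Q - 1 by lra.
have S0 : 0 < Q ^+ 2 + 1 by rewrite ltr_wpDl ?sqr_ge0.
have -> : y `^ (- (2 / 3)) = (y ^+ 2)^-1 `^ (1 / 3).
  have -> : (y ^+ 2)^-1 = y `^ (- 2%:R) by rewrite powRN powR_mulrn // ltW.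
  by rewrite -powRrM; congr powR; field.
set r := (_ * _) / y; set j := (Q - 1) / y.
have r0 : 0 < r by rewrite divr_gt0 ?mulr_gt0.
have j0 : 0 < j by rewrite divr_gt0.
have w0 : 0 < (y ^+ 2)^-1 * r by rewrite mulr_gt0 ?invr_gt0 ?exprn_gt0.
rewrite -powRM ?invr_ge0 ?sqr_ge0 ?ltW //.
have -> : j = ((Q - 1) ^+ 2 / (Q ^+ 2 + 1) * ((y ^+ 2)^-1 * r)) `^ (1 / 3).
  have -> : (Q - 1) ^+ 2 / (Q ^+ 2 + 1) * ((y ^+ 2)^-1 * r) = j ^+ 3.
    by rewrite /r /j; field; rewrite !gt_eqF.
  by rewrite powRX ?ltW // (_ : _ * _ = 1) ?powRr1 ?ltW //; field.
rewrite powRM ?mulfK ?gt_eqF ?powR_gt0 ?divr_ge0 ?sqr_ge0 ?ltW //.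
Unshelve. all: by end_near.
Qed.

Lemma ramsey_bounds (R : realType) (q : nat) : prime_power q ->
  exists c1 c2 : R, [/\ 0 < c1, 0 < c2 &
     forall m : nat, (0 < m)%N -> (2 < q ^ m)%N ->
       c1 * (par_r q m)%:R `^ (4 / 3)
         <= (set_ramsey (q + 1) (par_r q m) (par_s q m))%:R
         <= c2 * (par_r q m)%:R `^ (4 / 3)].
Proof.
move=> hq; have [C ramsey_le] := set_ramsey_le hq.
have q1 := prime_power_gt1 hq; have q'2 : 2 <= q%:R :> R by rewrite ler_nat.
exists 1, ((C%:R + 1) * (2 * q%:R) `^ (4 / 3)); split=> //.
  by rewrite mulr_gt0 ?powR_gt0 ?mulr_gt0 ?ltr_wpDl //; lra.
move=> m m0 Q2; have [_ qQ rE _ _] := @par_real R q m hq m0.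
have Q2' : 2 < q%:R ^+ m :> R by rewrite -natrX ltr_nat.
set Q := _ ^+ m in qQ rE Q2'; set r := (par_r q m)%:R in rE *.
have QE : (q ^ m)%:R = Q by rewrite natrX.
have Q4 : ((q ^ m) ^ 4)%:R = (Q ^+ 3) `^ (4 / 3).
  by rewrite (natrX _ (q ^ m)%N) QE powR_cube //; lra.
have y0 : 0 < q%:R - 1 :> R by lra.
have r0 : 0 <= r by [].
have mono (x y : R) : 0 <= x -> x <= y -> x `^ (4 / 3) <= y `^ (4 / 3).
  by move=> x0 xy; apply: ge0_ler_powR => //; rewrite ?nnegrE //; lra.
have X_le : (Q ^+ 2 + 1) * (Q - 1) <= Q ^+ 3.
  have -> : (Q ^+ 2 + 1) * (Q - 1) = Q ^+ 3 - Q ^+ 2 + (Q - 1) by ring.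
  by nra.
apply/andP; split.
  rewrite mul1r; apply: (@le_trans _ _ ((q ^ m) ^ 4)%:R).
    rewrite Q4; apply: mono => //; rewrite rE ler_pdivrMr //.
    apply: le_trans X_le _; rewrite ler_peMr ?exprn_ge0 //; lra.
  rewrite ler_nat; apply: leq_trans (max_code_ge hq m0) _.
  by apply: ltnW; apply: max_code_lt_set_ramsey; apply: par_s_between.
apply: (@le_trans _ _ (C%:R * (Q ^+ 3) `^ (4 / 3))).
  by rewrite -Q4 -natrM ler_nat ramsey_le.
rewrite -mulrA -powRM ?mulr_ge0 //.
apply: ler_pM; rewrite ?powR_ge0 ?ler0n //; first by lra.
apply: mono; first by rewrite exprn_ge0; lra.
rewrite rE mulrA ler_pdivlMr //.
apply: (@le_trans _ _ (Q ^+ 3 * q%:R)); first by rewrite ler_wpM2l ?exprn_ge0 //; lra.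
rewrite [X in _ <= X]mulrAC; apply: ler_wpM2r; first by lra.
have -> : 2 * ((Q ^+ 2 + 1) * (Q - 1)) = Q ^+ 3 + (Q ^+ 2 * (Q - 2) + 2 * (Q - 1)) by ring.
rewrite lerDl addr_ge0 ?mulr_ge0 ?sqr_ge0 //; lra.
Qed.

(** The error term is defined from the exact quotient; it is squeezed between
    the bounds coming from Q^4 and from Q^4 (Q^2 + 1) / (Q^2 - Q + 2). *)
Lemma max_code_asymptotics (R : realType) (q : nat) : prime_power q ->
  exists o1 : nat -> R, (o1 @ \oo --> (0 : R))%classic /\
    forall m : nat, (0 < m)%N -> (2 < q ^ m)%N ->
      (max_code q (par_r q m) (par_s q m))%:R
        = (1 + o1 m) * (q%:R - 1) `^ (4 / 3) * (par_r q m)%:R `^ (4 / 3).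
Proof.
move=> hq; have q1 := prime_power_gt1 hq.
pose D m : R := (q%:R - 1) `^ (4 / 3) * (par_r q m)%:R `^ (4 / 3).
pose A m : R := (max_code q (par_r q m) (par_s q m))%:R.
have D_gt0 m : (0 < m)%N -> 0 < D m.
  move=> m0; have [q'1 qQ rE _ _] := @par_real R q m hq m0.
  apply: mulr_gt0; apply: powR_gt0; first by lra.
  have := sqr_ge0 (q%:R ^+ m : R) => sq0.
  by rewrite rE; apply: divr_gt0; [apply: mulr_gt0|]; lra.
exists (fun m => A m / D m - 1); split; last first.
  move=> m m0 _; rewrite -mulrA -/(D m) subrKC divfK // gt_eqF //.
  exact: D_gt0.
rewrite -(subrr (1 : R)); apply: cvgB; last exact: cvg_cst.
pose f m : R := (q%:R ^+ m) ^+ 3 / (((q%:R ^+ m) ^+ 2 + 1) * (q%:R ^+ m - 1)).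
pose h m : R := ((q%:R ^+ m) ^+ 2 + 1) / ((q%:R ^+ m) ^+ 2 - q%:R ^+ m + 2).
have Q_facts m : (0 < m)%N -> [/\ 1 < q%:R ^+ m :> R, 0 < (q%:R ^+ m) ^+ 2 + 1 :> R &
    0 < (q%:R ^+ m) ^+ 2 - q%:R ^+ m + 2 :> R].
  move=> m0; have [q'1 qQ _ _ _] := @par_real R q m hq m0.
  have Q1 : 1 < q%:R ^+ m :> R by apply: lt_le_trans qQ.
  have := sqr_ge0 (q%:R ^+ m : R) => sq0; split; [exact: Q1|by lra|].
  by nra.
have f1 : (f @ \oo --> (1 : R))%classic.
  apply: (@cvg_ratio_invX R q f 1 ((1 + 'X ^+ 2) * (1 - 'X)) q1); rewrite ?hornerE;
    try ring.
  move=> m m0; have [Q1 Q2 _] := Q_facts m m0; rewrite /f !hornerE.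
  move: (q%:R ^+ m) Q1 Q2 => Q Q1 Q2; field.
  by rewrite ?(gt_eqF Q2) ?andbT; lra.
have h1 : (h @ \oo --> (1 : R))%classic.
  have hornerE' := (hornerD, hornerN, hornerX, horner_exp, hornerC).
  apply: (@cvg_ratio_invX R q h (1 + 'X ^+ 2) (1%:P - 'X + ('X ^+ 2 + 'X ^+ 2)) q1);
    rewrite ?hornerE'; try ring.
  move=> m m0; have [Q1 _ Q3] := Q_facts m m0; rewrite /h !hornerE'.
  move: (q%:R ^+ m) Q1 Q3 => Q Q1 Q3; field.
  by rewrite ?(gt_eqF Q3) ?andbT; lra.
have g1 := cvg_powR1 (4 / 3) f1.
have gh1 : ((fun m => f m `^ (4 / 3) * h m) @ \oo --> (1 : R))%classic.
  by rewrite -[X in (_ --> X)%classic](mulr1 1); apply: cvgM.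
(* f^(4/3) is Q^4 over the main term, and h is the loss in [max_code_le]. *)
apply: squeeze_cvgr g1 gh1.
near=> m; have m0 : (0 < m)%N by near: m; apply: nbhs_infty_gt.
have [Q1 Q2 Q3] := Q_facts m m0; have [q'1 _ rE _ _] := @par_real R q m hq m0.
have QE : (q ^ m)%:R = q%:R ^+ m :> R by rewrite natrX.
have := max_code_ge hq m0; have := max_code_le hq m0.
have le_sq : (q ^ m <= (q ^ m) ^ 2)%N by rewrite -mulnn leq_pmull // expn_gt0 ltnW.
rewrite -!(ler_nat R) natrM natrD (natrB _ le_sq) natrM natrD !(natrX _ (q ^ m)%N) QE -/(A m).
rewrite /f /h; move: (D_gt0 m m0); set Q := _ ^+ m in rE Q1 Q2 Q3 * => D0 upper lower.
have fE : (Q ^+ 3 / ((Q ^+ 2 + 1) * (Q - 1))) `^ (4 / 3) = Q ^+ 4 / D m.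
  have X0 : 0 < (Q ^+ 2 + 1) * (Q - 1) by rewrite mulr_gt0 //; lra.
  have -> : D m = ((Q ^+ 2 + 1) * (Q - 1)) `^ (4 / 3).
    rewrite /D rE -powRM ?divr_ge0 //; [|lra|exact: ltW|lra].
    by rewrite mulrC divfK // gt_eqF; lra.
  rewrite -(@powR_cube R Q) ?(le_trans ler01 (ltW Q1)) //.
  rewrite powRM ?invr_ge0 ?(ltW X0) ?exprn_ge0 ?(le_trans ler01 (ltW Q1)) //.
  by congr (_ * _); rewrite -powR_inv1 ?(ltW X0) // -powRrM mulN1r powRN.
rewrite fE ler_pM2r ?invr_gt0 // lower /=.
rewrite mulrAC ler_pM2r ?invr_gt0 // mulrA ler_pdivlMr //.
Unshelve. all: by end_near.
Qed.

Local Open Scope classical_set_scope.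
Local Open Scope ring_scope.

Theorem theorem1p2 (R : realType) (q : nat) (hq : prime_power q) :
  [/\ (* the three quotients are exact and define positive integers *)
      forall m : nat, (0 < m)%N -> (2 < q ^ m)%N ->
        let Q : R := q%:R ^+ m in
        [/\ (0 < par_r q m)%N, (0 < par_j q m)%N & (0 < par_s q m)%N] /\
        [/\ (par_r q m)%:R = (Q ^+ 2 + 1) * (Q - 1) / (q%:R - 1),
            (par_j q m)%:R = (Q - 1) / (q%:R - 1) &
            (par_s q m)%:R = Q ^+ 2 * (Q - 1) / q%:R],
      forall m : nat, (0 < m)%N -> (2 < q ^ m)%N ->
        (par_s q m)%:R
          = (1 - 1 / q%:R) * ((par_r q m)%:R - (par_j q m)%:R) :> R /\
        (par_s q m < par_r q m)%N,
      (fun m : nat => (par_j q m)%:R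
         / ((q%:R - 1) `^ (- (2 / 3)) * (par_r q m)%:R `^ (1 / 3)) : R)
        @ \oo --> (1 : R),
      (exists c1 c2 : R, [/\ 0 < c1, 0 < c2 &
         forall m : nat, (0 < m)%N -> (2 < q ^ m)%N ->
           c1 * (par_r q m)%:R `^ (4 / 3)
             <= (set_ramsey (q + 1) (par_r q m) (par_s q m))%:R
             <= c2 * (par_r q m)%:R `^ (4 / 3)]) &
      exists o1 : nat -> R, o1 @ \oo --> (0 : R) /\
        forall m : nat, (0 < m)%N -> (2 < q ^ m)%N ->
          (max_code q (par_r q m) (par_s q m))%:R
            = (1 + o1 m) * (q%:R - 1) `^ (4 / 3) * (par_r q m)%:R `^ (4 / 3)].
Proof.
have q1 := prime_power_gt1 hq; split.
- move=> m m0 Q2 Q; have [_ _ rE jE sE] := @par_real R q m hq m0.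
  have /andP[s0 sr] := par_s_between hq m0 Q2; split=> //.
  split=> //; first exact: ltn_trans sr.
  rewrite -(ltn_pmul2r (_ : 0 < q - 1)%N) ?subn_gt0 // mul0n par_j_nat //.
  by rewrite subn_gt0 ltnW.
- move=> m m0 Q2; have /andP[_ sr] := par_s_between hq m0 Q2; split=> //.
  have [q'1 _ -> -> ->] := @par_real R q m hq m0.
  by field; lra.
- exact: cvg_par_j.
- exact: ramsey_bounds.
- exact: max_code_asymptotics.
Qed.
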